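(* Let $\mathbb{F}_q$ be a finite field of characteristic different from $2$ and $3$, and let $E: y^2=x^3+Ax+B$ with $A,B\in\mathbb{F}_q$ be an elliptic curve. For $n\in\{3,5\}$ let $T_n$ be the trace zero subgroup of $E(\mathbb{F}_{q^n})$ associated with the field extension $\mathbb{F}_{q^n}|\mathbb{F}_q$, and let $f_n$ be the $n$-th summation polynomial of $E$. Then $$T_3=\{(X,Y)\in E(\mathbb{F}_{q^3})\mid f_3(X,X^q,X^{q^2})=0\}\cup\{\mathcal{O}\}$$ and $$T_5\cup\bigl(E[3](\mathbb{F}_q)+(E[2]\cap T_5)\bigr)=\{(X,Y)\in E(\mathbb{F}_{q^5})\mid f_5(X,X^q,X^{q^2},X^{q^3},X^{q^4})=0\}\cup\{\mathcal{O}\},$$ where for subgroups $G,H$ of $E(\overline{\mathbb{F}}_q)$ we write $G+H=\{Q+R\mid Q\in G,\ R\in H\}$.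
   Context: $\mathcal{O}$ denotes the point at infinity, the neutral element of $E$. For an integer $m$, $E[m]$ is the group of $m$-torsion points of $E$ over the algebraic closure $\overline{\mathbb{F}}_q$, and $E[m](\mathbb{F}_q)$ is its subgroup of $\mathbb{F}_q$-rational points. The Frobenius endomorphism is $\varphi:E\to E$, $(X,Y)\mapsto(X^q,Y^q)$, $\mathcal{O}\mapsto\mathcal{O}$. The trace map is $\mathrm{Tr}:E(\mathbb{F}_{q^n})\to E(\mathbb{F}_q)$, $P\mapsto P+\varphi(P)+\cdots+\varphi^{n-1}(P)$, and the trace zero subgroup is $T_n=\ker(\mathrm{Tr})\subseteq E(\mathbb{F}_{q^n})$. Semaev's summation polynomials $f_m\in\mathbb{F}_q[z_1,\ldots,z_m]$, $m\ge 3$, of $E$ are defined recursively by $$f_3(z_1,z_2,z_3)=(z_1-z_2)^2z_3^2-2\bigl((z_1+z_2)(z_1z_2+A)+2B\bigr)z_3+(z_1z_2-A)^2-4B(z_1+z_2),$$ $$f_m(z_1,\ldots,z_m)=\mathrm{Res}_z\bigl(f_{m-k}(z_1,\ldots,z_{m-k-1},z),\,f_{k+2}(z_{m-k},\ldots,z_m,z)\bigr)$$ for $m\ge4$ and $m-3\ge k\ge1$. A known theorem of Semaev, which may be used: for $m\geq 3$ and $Z_1,\ldots,Z_m\in\overline{\mathbb{F}}_q$, one has $f_m(Z_1,\ldots,Z_m)=0$ if and only if there exist $Y_1,\ldots,Y_m\in\overline{\mathbb{F}}_q$ such that the points $(Z_i,Y_i)$ lie on $E$ and $(Z_1,Y_1)+\cdots+(Z_m,Y_m)=\mathcal{O}$.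 Moreover $f_m$ is symmetric. *)

(* Defs.v *)
From HB Require Import structures.
From mathcomp Require Import all_boot all_order all_algebra all_fingroup all_solvable all_field.
From mathcomp Require Import mpoly.

Set Implicit Arguments.
Unset Strict Implicit.
Unset Printing Implicit Defensive.

Import GRing.Theory.
Local Open Scope ring_scope.

(* A copy of the algebraic closure of F: K is algebraically closed and
   algebraic over F via iota. *)
Definition is_alg_closure (F : finFieldType) (K : closedFieldType)
    (iota : {rmorphism F -> K}) : Prop :=
  forall x : K, algebraicOver iota x.

(* For q = #|F|, the subfield with q ^ n elements of an algebraic closure K of
   F; see Fqn_card and Fqn_subfield below. *)
Definition Fqn (F : finFieldType) (K : fieldType) (n : nat) : pred K :=
  [pred x : K | x ^+ (#|F| ^ n) == x].

(* Affine points (x, y) are Some (x, y); None is the point at infinity. *)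
Definition point (K : Type) : Type := option (K * K).

Definition on_curve (K : fieldType) (a b : K) (P : point K) : bool :=
  if P is Some (x, y) then y ^+ 2 == x ^+ 3 + a * x + b else true.

Definition rational (K : Type) (k : pred K) (P : point K) : bool :=
  if P is Some (x, y) then k x && k y else true.

(* Chord-and-tangent law of y^2 = x^3 + a x + b. On the curve, x1 = x2 and
   y1 <> - y2 force y1 = y2 <> 0, which is the tangent case. *)
Definition ec_add (K : fieldType) (a : K) (P Q : point K) : point K :=
  match P, Q with
  | None, _ => Q
  | _, None => P
  | Some (x1, y1), Some (x2, y2) =>
      if (x1 == x2) && (y1 == - y2) then None
      else
        let l := if x1 == x2 then (3%:R * x1 ^+ 2 + a) / (2%:R * y1)
                 else (y2 - y1) / (x2 - x1) in
        let x3 := l ^+ 2 - x1 - x2 in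
        Some (x3, l * (x1 - x3) - y1)
  end.

Definition ec_muln (K : fieldType) (a : K) (m : nat) (P : point K) : point K :=
  iter m (ec_add a P) None.

Definition frob (K : fieldType) (q : nat) (P : point K) : point K :=
  if P is Some (x, y) then Some (x ^+ q, y ^+ q) else None.

Definition ec_trace (K : fieldType) (a : K) (q n : nat) (P : point K) :
    point K :=
  \big[ec_add a/None]_(i < n) iter i (frob q) P.

Definition ec_rat (K : fieldType) (a b : K) (k : pred K) (P : point K) :
    bool :=
  on_curve a b P && rational k P.

Definition ec_torsion (K : fieldType) (a b : K) (m : nat) (P : point K) :
    bool :=
  on_curve a b P && (ec_muln a m P == None).

Definition trace_zero (F : finFieldType) (K : fieldType) (a b : K) (n : nat)
    (P : point K) : bool :=
  ec_rat a b (Fqn F n) P && (ec_trace a #|F| n P == None).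

Definition pt_sumset (K : fieldType) (a : K) (G H : pred (point K))
    (P : point K) : Prop :=
  exists Q R, [/\ G Q, H R & P = ec_add a Q R].

Definition semaev3 (F : fieldType) (A B : F) : {mpoly F[3]} :=
  let z1 := 'X_(inord 0) in
  let z2 := 'X_(inord 1) in
  let z3 := 'X_(inord 2) in
  (z1 - z2) ^+ 2 * z3 ^+ 2
  - 2%:R * ((z1 + z2) * (z1 * z2 + A%:MP) + 2%:R * B%:MP) * z3
  + (z1 * z2 - A%:MP) ^+ 2 - 4%:R * B%:MP * (z1 + z2).

(* f(z_{s 0}, ..., z_{s (c-1)}, z) for f in c + 1 variables, as a polynomial
   in z with coefficients in F[z_0, ..., z_{m-1}]. *)
Definition subst_last (F : fieldType) (c m : nat) (s : 'I_c -> 'I_m)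
    (f : {mpoly F[c.+1]}) : {poly {mpoly F[m]}} :=
  mmap (polyC \o @mpolyC m F)
       (fun i => if unlift ord_max i is Some j then ('X_(s j))%:P else 'X) f.

(* Res_z (g(z_1, ..., z_c, z), h(z_{c+1}, ..., z_{c+d}, z)) *)
Definition semaev_res (F : fieldType) (c d : nat)
    (g : {mpoly F[c.+1]}) (h : {mpoly F[d.+1]}) : {mpoly F[c + d]} :=
  resultant (subst_last (@lshift c d) g) (subst_last (@rshift c d) h).

(* summation_poly A B f: f, in m variables, is obtained as an m-th summation
   polynomial by Semaev's recursion
     f_m = Res_z (f_{m-k}(z_1, ..., z_{m-k-1}, z), f_{k+2}(z_{m-k}, ..., z_m, z))
   with any choice of 1 <= k <= m - 3 at each step. Here c = m - k - 1 and
   d = k + 1; the bounds on k say that both factors have at least 3 variables,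
   which holds for every inhabited instance of the predicate. *)
Inductive summation_poly (F : fieldType) (A B : F) :
    forall m : nat, {mpoly F[m]} -> Prop :=
| SummationPoly3 : summation_poly A B (semaev3 A B)
| SummationPolyRes (c d : nat) (g : {mpoly F[c.+1]}) (h : {mpoly F[d.+1]}) :
    summation_poly A B g -> summation_poly A B h ->
    summation_poly A B (semaev_res g h).

(* The affine points (X, Y) of E(F_{q^n}) with
   f(X, X^q, ..., X^(q^(n-1))) = 0. *)
Definition frob_zero_locus (F : finFieldType) (K : fieldType)
    (iota : {rmorphism F -> K}) (a b : K) (n : nat) (f : {mpoly F[n]})
    (P : point K) : Prop :=
  exists X Y : K,
    [/\ P = Some (X, Y), ec_rat a b (Fqn F n) P
      & (map_mpoly iota f).@[fun i : 'I_n => X ^+ (#|F| ^ i)] = 0].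

Lemma summation_poly_ge3 (F : fieldType) (A B : F) (m : nat)
    (f : {mpoly F[m]}) :
  summation_poly A B f -> (3 <= m)%N.
Proof.
elim=> // c d g h _ c2 _ d2.
by apply: (@leq_trans (2 + 2)) => //; apply: leq_add.
Qed.

Lemma summation_poly_ex (F : fieldType) (A B : F) (m : nat) :
  (3 <= m)%N -> exists f : {mpoly F[m]}, summation_poly A B f.
Proof.
case: m => [|[|[|m]]] // _; elim: m => [|m [f fP]].
  by exists (semaev3 A B); constructor.
rewrite -[m.+4]addn2.
exists (semaev_res f (semaev3 A B : {mpoly F[2.+1]})).
by apply: SummationPolyRes => //; constructor.
Qed.

Lemma Fqn_card (F : finFieldType) (K : closedFieldType)
    (iota : {rmorphism F -> K}) (n : nat) :
  (0 < n)%N ->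
  exists s : seq K, [/\ uniq s, size s = (#|F| ^ n)%N & s =i Fqn F n].
Proof.
move=> n0; set N := (#|F| ^ n)%N.
have F1 : (1 < #|F|)%N by apply: finNzRing_gt1.
have N1 : (1 < N)%N by rewrite -(expn0 #|F|) ltn_exp2l.
have F0 : #|F|%:R = 0 :> F.
  by rewrite -FinRing.zmodXgE -cardsT expg_cardG ?inE.
have N0 : N%:R = 0 :> K.
  by rewrite -(rmorph_nat iota) natrX F0 expr0n eqn0Ngt n0 rmorph0.
pose P : {poly K} := 'X^N - 'X.
have sP : size P = N.+1.
  by rewrite size_polyDl size_polyXn // size_polyN size_polyX ltnS.
have lP : lead_coef P = 1.
  by rewrite lead_coefDl ?lead_coefXn // size_polyN size_polyX size_polyXn ltnS.
have [s sE] := closed_field_poly_normal P.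
rewrite lP scale1r in sE.
exists s; split.
- rewrite -separable_prod_XsubC -sE unlock derivB derivXn derivX.
  by rewrite -mulr_natr -polyC_natr N0 mulr0 sub0r -scaleN1r
             coprimepZr ?oppr_eq0 ?oner_eq0 // coprimep1.
- by apply/succn_inj; rewrite -sP sE size_prod_XsubC.
by move=> x; rewrite -root_prod_XsubC -sE rootE !hornerE subr_eq0 !inE.
Qed.

Lemma Fqn_subfield (F : finFieldType) (K : closedFieldType)
    (iota : {rmorphism F -> K}) (n : nat) :
  divring_closed (Fqn F n : pred K).
Proof.
have [p pr_p pF] := finPcharP F.
have NK : [pchar K].-nat (#|F| ^ n)%N.
  rewrite (card_pprimeChar pF) pnatX; apply/orP; left; rewrite pnatX.
  by rewrite pnatE // (fmorph_pchar iota) pF.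
split; first by rewrite !inE expr1n.
- move=> x y /eqP xE /eqP yE; rewrite !inE exprDn_pchar // exprNn_pchar //.
  by rewrite xE yE.
- move=> x y /eqP xE /eqP yE; rewrite !inE exprMn exprVn.
  by rewrite xE yE.
Qed.

(* Main.v *)
(* A coordinate ring K[x, y] / (y^2 - x^3 - a x - b) has no element whose norm
   to K[x] has degree 1, so P |-> class of the maximal ideal of P is injective;
   as the ideals of three collinear points have a principal product, this map
   turns the chord-and-tangent law into multiplication of ideal classes, and
   the curve is a group.

   Semaev's theorem holds for tuples of points of the projective line: the
   multihomogenization of f_m vanishes at (Z_1, ..., Z_m) iff some points P_i
   with x(P_i) = Z_i sum to 0. This passes to resultants since a Sylvester
   determinant detects common roots, the root at infinity included.

   So f_n(X, X^q, ...) = 0 says that sum_i e_i phi^i(P) = 0 for some signs e_i,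
   where phi is the Frobenius. If N is the set of negative signs, then
   Tr P = 2 sum_{i in N} phi^i(P), and applying Tr gives n Tr P = 2 #|N| Tr P.
   As N may be replaced with its complement, let 2 #|N| <= n. Then Tr P = 0
   unless n = 5 and #|N| = 1, in which case Tr P = 2 P is a rational 3-torsion
   point t, and P = (- t) + (P + t). *)
From HB Require Import structures.
Require Import Defs.
From mathcomp Require Import all_boot all_order all_algebra.
From mathcomp Require Import perm finfield.
From mathcomp Require Import mpoly.
From mathcomp Require Import ring zify.

Set Implicit Arguments.
Unset Strict Implicit.
Unset Printing Implicit Defensive.

Import GRing.Theory.
Local Open Scope ring_scope.

(** * Ideals and their classes *)

Section IdealClasses.

Variable R : comNzRingType.
Implicit Types (s t u : seq R) (x y f g : R).

(** The ideal generated by [s], given inductively so that proofs go by induction on membership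
    instead of handling lists of coefficients. *)
Inductive ideal_span s : R -> Prop :=
| Span0 : ideal_span s 0
| SpanD x y : ideal_span s x -> ideal_span s y -> ideal_span s (x + y)
| SpanZ c g : g \in s -> ideal_span s (c * g).

Lemma span_mem s g : g \in s -> ideal_span s g.
Proof. by move=> gs; rewrite -[g]mul1r; apply: SpanZ. Qed.

Lemma spanM s c x : ideal_span s x -> ideal_span s (c * x).
Proof.
elim=> [|y z _ IHy _ IHz|d g gs]; first by rewrite mulr0; apply: Span0.
  by rewrite mulrDr; apply: SpanD.
by rewrite mulrA; apply: SpanZ.
Qed.

Lemma spanN s x : ideal_span s x -> ideal_span s (- x).
Proof. by rewrite -mulN1r; apply: spanM. Qed.

Definition subideal s t := forall g, g \in s -> ideal_span t g.
Definition eqideal s t := subideal s t /\ subideal t s.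

Lemma subideal_span s t x : subideal s t -> ideal_span s x -> ideal_span t x.
Proof.
move=> st; elim=> [|y z _ IHy _ IHz|d g gs]; first exact: Span0.
  exact: SpanD.
by apply: spanM; apply: st.
Qed.

Lemma subideal_mem s t : {subset s <= t} -> subideal s t.
Proof. by move=> st g /st; apply: span_mem. Qed.

Lemma subideal_trans s t u : subideal s t -> subideal t u -> subideal s u.
Proof. by move=> st tu g /st; apply: subideal_span. Qed.

Lemma eqideal_mem s t : s =i t -> eqideal s t.
Proof. by move=> st; split; apply: subideal_mem => x; rewrite st. Qed.

Lemma eqideal_refl s : eqideal s s.
Proof. exact: eqideal_mem. Qed.

Lemma eqideal_sym s t : eqideal s t -> eqideal t s.
Proof. by case. Qed.

Lemma eqideal_trans s t u : eqideal s t -> eqideal t u -> eqideal s u.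
Proof. by move=> [st ts] [tu ut]; split; apply: subideal_trans; eassumption.
  Qed.

Definition mulideal s t := [seq x * y | x <- s, y <- t].
Definition scaleideal f s := [seq f * x | x <- s].

Lemma mulidealP s t z :
  reflect (exists x y, [/\ x \in s, y \in t & z = x * y]) (z \in mulideal s t).
Proof.
apply: (iffP allpairsP) => [[[x y] [/= xs yt ->]]|[x [y [xs yt ->]]]].
  by exists x, y.
by exists (x, y).
Qed.

Lemma span_mul s t x y : ideal_span s x -> ideal_span t y ->
  ideal_span (mulideal s t) (x * y).
Proof.
move=> sx ty; elim: sx => [|x1 x2 _ IH1 _ IH2|c g gs].
- by rewrite mul0r; apply: Span0.
- by rewrite mulrDl; apply: SpanD.
rewrite -mulrA; apply: spanM; elim: ty => [|y1 y2 _ IH1 _ IH2|d h ht].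
- by rewrite mulr0; apply: Span0.
- by rewrite mulrDr; apply: SpanD.
by rewrite mulrCA; apply: SpanZ; apply/mulidealP; exists g, h.
Qed.

Lemma subideal_mul s s' t t' :
  subideal s s' -> subideal t t' -> subideal (mulideal s t) (mulideal s' t').
Proof.
by move=> ss tt z /mulidealP[x [y [/ss sx /tt ty ->]]]; apply: span_mul.
Qed.

Lemma eqideal_mul s s' t t' :
  eqideal s s' -> eqideal t t' -> eqideal (mulideal s t) (mulideal s' t').
Proof. by move=> [? ?] [? ?]; split; apply: subideal_mul. Qed.

Lemma mulidealC s t : mulideal s t =i mulideal t s.
Proof.
move=> z; apply/mulidealP/mulidealP => -[x [y [xs yt ->]]];
by exists y, x; rewrite mulrC.
Qed.

Lemma mulidealA s t u :
  mulideal s (mulideal t u) =i mulideal (mulideal s t) u.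
Proof.
move=> z; apply/mulidealP/mulidealP.
  case=> [x [_ [xs /mulidealP[y [w [yt wu ->]]] ->]]].
  by exists (x * y), w; rewrite mulrA; split=> //; apply/mulidealP; exists x, y.
case=> [_ [w [/mulidealP[x [y [xs yt ->]]] wu ->]]].
by exists x, (y * w); rewrite mulrA; split=> //; apply/mulidealP; exists y, w.
Qed.

Lemma mulideal1 f s : mulideal [:: f] s = scaleideal f s.
Proof. by rewrite /mulideal /= cats0. Qed.

Lemma scaleideal1 s : scaleideal 1 s = s.
Proof. by rewrite /scaleideal (eq_map (@mul1r _)) map_id. Qed.

Lemma subideal_scale f s t :
  subideal s t -> subideal (scaleideal f s) (scaleideal f t).
Proof. by move=> st; rewrite -!mulideal1;
  apply: subideal_mul => // g /span_mem. Qed.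

Lemma eqideal_scale f s t :
  eqideal s t -> eqideal (scaleideal f s) (scaleideal f t).
Proof. by move=> [? ?]; split; apply: subideal_scale. Qed.

Lemma scaleidealA f g s : scaleideal f (scaleideal g s) = scaleideal (f * g) s.
Proof. by rewrite /scaleideal -map_comp; apply: eq_map => x /=;
  rewrite mulrA. Qed.

Lemma scaleidealM f g s t :
  mulideal (scaleideal f s) (scaleideal g t) =i
  scaleideal (f * g) (mulideal s t).
Proof.
move=> z; apply/mulidealP/mapP.
  case=> [_ [_ [/mapP[x xs ->] /mapP[y yt ->] ->]]].
  by exists (x * y); [apply/mulidealP; exists x, y | ring].
case=> [_ /mulidealP[x [y [xs yt ->]]] ->].
exists (f * x), (g * y); split; [exact: map_f|exact: map_f|ring].
Qed.

(** The relation f I = g J of ideal classes. The multipliers are regular elements, so that it makes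
    sense in a ring not known to be a domain. *)
Definition same_class s t := exists f g,
  [/\ GRing.lreg f, GRing.lreg g & eqideal (scaleideal f s) (scaleideal g t)].

Lemma eqideal_class s t : eqideal s t -> same_class s t.
Proof.
by move=> st; exists 1, 1; rewrite !scaleideal1; split=> //; apply: lreg1.
Qed.

Lemma same_class_sym s t : same_class s t -> same_class t s.
Proof. by move=> [f [g [? ? /eqideal_sym ?]]]; exists g, f. Qed.

Lemma same_class_trans s t u : same_class s t -> same_class t u ->
  same_class s u.
Proof.
move=> [f [g [rf rg E]]] [f' [g' [rf' rg' E']]].
exists (f' * f), (g * g'); split; try exact: lregM.
rewrite -!scaleidealA; apply: eqideal_trans (eqideal_scale f' E) _.
by rewrite scaleidealA mulrC -scaleidealA; apply: eqideal_scale.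
Qed.

Lemma same_class_mul s s' t t' : same_class s s' -> same_class t t' ->
  same_class (mulideal s t) (mulideal s' t').
Proof.
move=> [f [g [rf rg E]]] [f' [g' [rf' rg' E']]].
exists (f * f'), (g * g'); split; try exact: lregM.
apply: eqideal_trans; first by apply/eqideal_sym/eqideal_mem/scaleidealM.
apply: eqideal_trans; last by apply/eqideal_mem/scaleidealM.
exact: eqideal_mul.
Qed.

Lemma same_class_principal f s :
  GRing.lreg f -> eqideal s [:: f] -> same_class s [:: 1].
Proof.
move=> rf E; exists 1, f; rewrite scaleideal1 /scaleideal /= mulr1.
by split=> //; apply: lreg1.
Qed.

End IdealClasses.

(* The coordinate ring K[x, y] / (y^2 - x^3 - a x - b), with (u, v) standing
   for u(x) + v(x) y. *)
Definition coord_ring (K : fieldType) (a b : K) : Type :=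
  ({poly K} * {poly K})%type.

(** * Arithmetic of the coordinate ring and its norm *)

Section CoordRing.

Variables (K : fieldType) (a b : K).
Local Notation R := (coord_ring a b).

HB.instance Definition _ := GRing.Zmodule.on R.

Definition cubic : {poly K} := 'X^3 + a%:P * 'X + b%:P.

Definition coord_mul (f g : R) : R :=
  (f.1 * g.1 + f.2 * g.2 * cubic, f.1 * g.2 + f.2 * g.1).

Fact coord_mulA : associative coord_mul.
Proof. by move=> [? ?] [? ?] [? ?]; congr pair => /=; ring. Qed.
Fact coord_mulC : commutative coord_mul.
Proof. by move=> [? ?] [? ?]; congr pair => /=; ring. Qed.
Fact coord_mul1 : left_id ((1, 0) : R) coord_mul.
Proof. by move=> [? ?]; congr pair => /=; ring. Qed.
Fact coord_mulDl : left_distributive coord_mul +%R.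
Proof. by move=> [? ?] [? ?] [? ?]; congr pair => /=; ring. Qed.
Fact coord_1_neq0 : ((1, 0) : R) != 0.
Proof. by apply/eqP => -[/eqP]; rewrite oner_eq0. Qed.

HB.instance Definition _ := GRing.Zmodule_isComNzRing.Build R
  coord_mulA coord_mulC coord_mul1 coord_mulDl coord_1_neq0.

Definition coord_poly (p : {poly K}) : R := (p, 0).

Fact coord_poly_additive : zmod_morphism coord_poly.
Proof. by move=> p q; congr pair; rewrite /= subr0. Qed.
Fact coord_poly_multiplicative : monoid_morphism coord_poly.
Proof. by split=> // p q; congr pair => /=; ring. Qed.

HB.instance Definition _ := GRing.isZmodMorphism.Build _ _ coord_poly
  coord_poly_additive.
HB.instance Definition _ := GRing.isMonoidMorphism.Build _ _ coord_poly
  coord_poly_multiplicative.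

Definition coord_y : R := (0, 1).

Lemma coord_y2 : coord_y * coord_y = coord_poly cubic.
Proof. by congr pair => /=; ring. Qed.

(** The product of u + v y with its conjugate u - v y. *)
Definition coord_norm (f : R) : {poly K} := f.1 ^+ 2 - f.2 ^+ 2 * cubic.

Lemma coord_normM f g : coord_norm (f * g) = coord_norm f * coord_norm g.
Proof. by case: f g => [u v] [u' v']; rewrite /coord_norm /=; ring. Qed.

Lemma size_cubic : size cubic = 4%N.
Proof.
rewrite /cubic -addrA size_polyDl size_polyXn // size_MXaddC.
by case: ifP => // _; rewrite ltnS ltnS (leq_trans (size_polyC_leq1 _)).
Qed.

(** A nonzero square u^2 has even degree, and v^2 times the cubic has odd degree at least 3 for v
    nonzero. Leading terms thus never cancel, and a norm of odd degree has degree at least 3. *)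
Lemma coord_norm_size f : size (coord_norm f) != 2%N.
Proof.
case: f => u v; rewrite /coord_norm /=.
have size_sqr (p : {poly K}) : p != 0 -> size (p ^+ 2) = (size p).-1.*2.+1.
  move=> p0; rewrite expr2 size_mul // -addnn.
  by case: (size p) (size_poly_gt0 p) => [|n _]; rewrite ?p0 ?addSnnS ?addnS.
have cubic0 : cubic != 0 by rewrite -size_poly_gt0 size_cubic.
have [->|v0] := eqVneq v 0.
  rewrite expr0n mul0r subr0.
  have [->|/size_sqr->] := eqVneq u 0; first by rewrite expr0n size_poly0.
  by apply/eqP => /(congr1 odd); rewrite /= odd_double.
have sv : size (v ^+ 2 * cubic) = ((size v).-1.+2).*2.
  by rewrite size_mul ?expf_neq0 // size_cubic size_sqr // !addnS addn0.
have [->|u0] := eqVneq u 0.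
  by rewrite expr0n sub0r size_polyN sv.
have su := size_sqr u u0.
have [lt|gt|eq] := ltngtP (size (u ^+ 2)) (size (v ^+ 2 * cubic)).
- by rewrite addrC size_polyDl ?size_polyN // sv.
- rewrite size_polyDl ?size_polyN // su.
  by apply/eqP => /(congr1 odd); rewrite /= odd_double.
by move: (congr1 odd eq); rewrite su sv /= !odd_double.
Qed.

(** Multiplying by the conjugate turns [f] into its norm, an element of the domain K[x] acting on
    both components. *)
Lemma coord_norm_lreg f : coord_norm f != 0 -> GRing.lreg f.
Proof.
move=> N0 x y /(congr1 (fun z => ((f.1, - f.2) : R) * z)); rewrite !mulrA.
have -> : ((f.1, - f.2) : R) * f = coord_poly (coord_norm f).
  by case: f {N0} => u v; congr pair; rewrite /coord_norm /=; ring.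
case: x y => [x1 x2] [y1 y2] [] /=; rewrite !mul0r !addr0.
by move=> /(mulfI N0)-> /(mulfI N0)->.
Qed.

End CoordRing.

Lemma span_gcd (K : fieldType) (s : seq {poly K}) :
  exists2 d, ideal_span s d & forall p, p \in s -> d %| p.
Proof.
elim: s => [|p s [d sd dP]]; first by exists 0; [apply: Span0 | ].
have [[u v] /= E] := Bezoutp p d.
exists (u * p + v * d).
  apply: SpanD; first by apply: SpanZ; rewrite mem_head.
  by apply/spanM/(subideal_span _ sd)/subideal_mem => q qs;
    rewrite in_cons qs orbT.
move=> q; rewrite in_cons (eqp_dvdl _ E) => /orP[/eqP->|/dP dq].
  exact: dvdp_gcdl.
exact: dvdp_trans (dvdp_gcdr _ _) dq.
Qed.

(** The Nullstellensatz in one variable: by Bezout the gcd lies in the ideal, and over an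
    algebraically closed field a gcd without roots is a nonzero constant. *)
Lemma span_no_root (K : closedFieldType) (s : seq {poly K}) :
  (forall t, exists2 p, p \in s & ~~ root p t) -> ideal_span s 1.
Proof.
move=> noroot; have [d sd dP] := span_gcd s.
have /size_poly1P[c c0 dE] : size d == 1%N.
  apply/negPn/negP => /closed_rootP[t dt].
  have [p /dP dp /negP[]] := noroot t.
  by move: dp => /dvdpP[c ->]; rewrite rootM dt orbT.
have <- : (c^-1)%:P * d = 1 by rewrite dE -polyCM mulVf.
exact: spanM.
Qed.

(** * Ideals of points and their products along a line *)

Section PointIdeals.

Variables (K : closedFieldType) (a b : K).
Hypotheses (two_neq0 : 2%:R != 0 :> K)
           (smooth : 4%:R * a ^+ 3 + 27%:R * b ^+ 2 != 0).

Local Notation R := (coord_ring a b).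
Local Notation w := (cubic a b).
Local Notation "p %:R'" := (@coord_poly K a b p) (at level 2, format "p %:R'").
Local Notation y := (@coord_y K a b).
Local Notation "I ** J" := (mulideal I J) (at level 40).

Lemma coord_poly_span (s : seq {poly K}) p :
  ideal_span s p -> ideal_span [seq q%:R' | q <- s] p%:R'.
Proof.
elim=> [|q r _ IHq _ IHr|c g gs].
- by rewrite rmorph0; apply: Span0.
- by rewrite rmorphD; apply: SpanD.
by rewrite rmorphM; apply/SpanZ/map_f.
Qed.

(** A double root t would give a = - 3 t^2 and b = 2 t^3, for which the discriminant vanishes. *)
Lemma cubic_simple_root t : root w t -> ~~ root w^`() t.
Proof.
rewrite !rootE /cubic derivD derivD derivM derivXn !derivC derivX !hornerE /=.
move=> /eqP w0; apply: contraNneq smooth => w'0.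
have aE : a = - (3%:R * t ^+ 2) by apply/eqP; rewrite -subr_eq0 -w'0;
  apply/eqP; ring.
have bE : b = 2%:R * t ^+ 3 by apply/eqP; rewrite -subr_eq0 -w0 aE;
  apply/eqP; ring.
by rewrite aE bE; apply/eqP; ring.
Qed.

(** The functions vanishing at the point; the point at infinity, as neutral element, gets the unit
    ideal. *)
Definition point_ideal (P : point K) : seq R :=
  if P is Some (x0, y0) then [:: ('X - x0%:P)%:R'; y - y0%:P%:R'] else [:: 1].

(** Modulo [X - x0], [y - l] agrees with [y - y0]. This lets the ideals of several points on one
    line share the generator [y - l]. *)
Lemma point_ideal_line (x0 y0 : K) (l : {poly K}) : l.[x0] = y0 ->
  eqideal (point_ideal (Some (x0, y0))) [:: ('X - x0%:P)%:R'; y - l%:R'].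
Proof.
move=> ly.
have /factor_theorem[h hE] : root (l - y0%:P) x0 by rewrite rootE !hornerE ly
  subrr.
have lE : l = h * ('X - x0%:P) + y0%:P by rewrite -hE subrK.
have in1 (f g : R) : ideal_span [:: f; g] f by apply: span_mem;
  rewrite mem_head.
have in2 (f g : R) : ideal_span [:: f; g] g by apply: span_mem;
  rewrite !inE eqxx orbT.
rewrite /point_ideal; split=> g; rewrite !inE => /orP[/eqP->|/eqP->];
  try exact: in1.
  have -> : y - y0%:P%:R' = (y - l%:R') + h%:R' * ('X - x0%:P)%:R'.
    by rewrite lE rmorphD rmorphM; ring.
  by apply: SpanD => //; apply: spanM.
have -> : y - l%:R' = (y - y0%:P%:R') - h%:R' * ('X - x0%:P)%:R'.
  by rewrite lE rmorphD rmorphM; ring.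
by apply: SpanD => //; (apply: spanN; apply: spanM).
Qed.

(** The vertical line through a point meets the curve in that point and its opposite, so the two
    ideals have inverse classes. *)
Lemma point_ideal_opp (x0 y0 : K) : on_curve a b (Some (x0, y0)) ->
  eqideal (point_ideal (Some (x0, y0)) ** point_ideal (Some (x0, - y0)))
    [:: ('X - x0%:P)%:R'].
Proof.
move=> /eqP onc; set X := 'X - _.
have /factor_theorem[h hE] : root (w - (y0 ^+ 2)%:P) x0.
  by rewrite rootE /cubic !hornerE onc subrr.
have wE : w = h * X + (y0 ^+ 2)%:P by rewrite -hE subrK.
have yyE : (y - y0%:P%:R') * (y - (- y0)%:P%:R') = h%:R' * X%:R'.
  transitivity (y * y - (y0 ^+ 2)%:P%:R');
    first by rewrite !rmorphN !rmorphXn; ring.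
  by rewrite coord_y2 wE rmorphD rmorphM addrK.
split=> g.
  move=> /mulidealP[g1 [g2 [+ + ->]]]; rewrite !inE.
  have inX (f : R) : ideal_span [:: X%:R'] (f * X%:R').
    by apply: SpanZ; rewrite mem_head.
  move=> /orP[]/eqP-> /orP[]/eqP->; rewrite ?yyE //; first by rewrite mulrC.
rewrite inE => /eqP->; set J := mulideal _ _.
have JM f1 f2 : f1 \in [:: X%:R'; y - y0%:P%:R'] ->
    f2 \in [:: X%:R'; y - (- y0)%:P%:R'] -> ideal_span J (f1 * f2).
  by move=> ? ?; apply: span_mem; apply/mulidealP; exists f1, f2.
have in1 (f k : R) : f \in [:: f; k] by rewrite mem_head.
have in2 (f k : R) : k \in [:: f; k] by rewrite !inE eqxx orbT.
(* [J] contains the products of [X] with these three polynomials, hence [X] itself once they have no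
   common root. At [x0], either [y0] is nonzero, or [x0] is a simple root of the cubic and [h] does
   not vanish there. *)
have : ideal_span [:: X; h; (2%:R * y0)%:P] 1.
  apply: span_no_root => t.
  have [ty|y00] := eqVneq y0 0; last first.
    exists (2 * y0)%:P; first by rewrite !inE eqxx !orbT.
    by rewrite rootC mulf_neq0.
  have [->|tx] := eqVneq t x0; last first.
    by exists X; rewrite ?mem_head // root_XsubC.
  exists h; first by rewrite !inE eqxx orbT.
  have wX : w = h * X by rewrite wE ty expr0n addr0.
  have := @cubic_simple_root x0.
  rewrite wX rootM root_XsubC eqxx orbT => /(_ isT).
  rewrite derivM derivXsubC mulr1 rootE hornerD hornerM hornerXsubC subrr mulr0.
  by rewrite add0r rootE.
move=> /coord_poly_span /=; rewrite rmorph1 => H1; rewrite -[_%:R']mulr1.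
elim: H1 => [|f g' _ IHf _ IHg|c f]; first by rewrite mulr0; apply: Span0.
  by rewrite mulrDr; apply: SpanD.
move=> fP; rewrite mulrCA; apply: spanM; move: fP;
  rewrite !inE => /or3P[]/eqP->.
- exact: JM.
- by rewrite mulrC -yyE; apply: JM.
have -> : X%:R' * (2 * y0)%:P%:R' =
    X%:R' * (y - (- y0)%:P%:R') - (y - y0%:P%:R') * X%:R'.
  by rewrite mulr_natl mulr2n rmorphN !rmorphD rmorphN; ring.
by apply: SpanD; [|apply: spanN]; apply: JM.
Qed.

(* Divided by y - l, the product contains 4 l^2 and the (X - x_i) (X - x_j); a
   common root of these polynomials would be a multiple root of the cubic. *)
Lemma point_ideal_chord (l : {poly K}) (x1 x2 x3 : K) :
  w - l ^+ 2 = ('X - x1%:P) * ('X - x2%:P) * ('X - x3%:P) ->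
  eqideal (point_ideal (Some (x1, l.[x1])) ** (point_ideal (Some (x2,
    l.[x2])) **
             point_ideal (Some (x3, l.[x3])))) [:: y - l%:R'].
Proof.
move=> wE; set L := y - _.
set X1 := 'X - x1%:P in wE *; set X2 := 'X - x2%:P in wE *.
set X3 := 'X - x3%:P in wE *.
have E i : eqideal (point_ideal (Some (i, l.[i]))) [:: ('X - i%:P)%:R'; L].
  exact: point_ideal_line.
apply: eqideal_trans (eqideal_mul (E _) (eqideal_mul (E _) (E _))) _.
rewrite -/X1 -/X2 -/X3.
have LL : X1%:R' * (X2%:R' * X3%:R') = (y + l%:R') * L.
  have -> : X1%:R' * (X2%:R' * X3%:R') = w%:R' - l%:R' ^+ 2.
    by rewrite -rmorphXn -rmorphB wE !rmorphM mulrA.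
  by rewrite -coord_y2 /L; ring.
split=> g.
  have inL (f : R) : ideal_span [:: L] (f * L) by apply: SpanZ;
    rewrite mem_head.
  move=> /mulidealP[g1 [_ [+ /mulidealP[g2 [g3 [+ + ->]]] ->]]]; rewrite !inE.
  move=> /orP[]/eqP-> /orP[]/eqP-> /orP[]/eqP->; rewrite ?LL //;
    by rewrite ?mulrA // 1?mulrC 1?mulrA // mulrAC.
rewrite inE => /eqP->; set J := mulideal _ _.
have JM f1 f2 f3 : f1 \in [:: X1%:R'; L] -> f2 \in [:: X2%:R'; L] ->
   f3 \in [:: X3%:R'; L] -> ideal_span J (f1 * (f2 * f3)).
  move=> ? ? ?; apply: span_mem; apply/mulidealP; exists f1, (f2 * f3).
  by split=> //; apply/mulidealP; exists f2, f3.
have in1 (f k : R) : f \in [:: f; k] by rewrite mem_head.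
have in2 (f k : R) : k \in [:: f; k] by rewrite !inE eqxx orbT.
have : ideal_span [:: X1 * X2; X1 * X3; X2 * X3; 4%:R * l ^+ 2] 1.
  apply: span_no_root => t.
  have [lt|lt] := eqVneq l.[t] 0; last first.
    exists (4%:R * l ^+ 2); first by rewrite !inE eqxx !orbT.
    have four_neq0 : 4%:R != 0 :> K by rewrite (natrM _ 2 2) mulf_neq0.
    by rewrite rootE hornerM horner_exp -polyC_natr hornerC mulf_neq0
      ?expf_neq0.
  suff : ~~ [&& root (X1 * X2) t, root (X1 * X3) t & root (X2 * X3) t].
    rewrite !negb_and => /or3P[] H; [exists (X1 * X2) | exists (X1 * X3) |
      exists (X2 * X3)] => //; by rewrite !inE eqxx ?orbT.
  apply/negP => /and3P[r12 r13 r23].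
  have H p q : root (p * q) t -> p.[t] * q.[t] = 0.
    by rewrite rootE hornerM => /eqP.
  have wE' : w = X1 * X2 * X3 + l * l by rewrite -wE expr2 subrK.
  have wt : root w t.
    by rewrite rootE wE' hornerD !hornerM lt mulr0 addr0 (H _ _ r12) mul0r.
  have /negP[] := cubic_simple_root wt.
  rewrite rootE wE' derivD !derivM !derivXsubC mul1r !mulr1.
  clearbody X1 X2 X3.
  rewrite !(hornerD, hornerM) lt mulr0 mul0r !addr0 mulrDl.
  by rewrite (H _ _ r12) (H _ _ r13) (H _ _ r23) !addr0.
move=> /coord_poly_span /=; rewrite rmorph1 => H1; rewrite -[L]mulr1.
elim: H1 => [|f g' _ IHf _ IHg|c f]; first by rewrite mulr0; apply: Span0.
  by rewrite mulrDr; apply: SpanD.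
move=> fP; rewrite mulrCA; apply: spanM; move: fP;
  rewrite !inE => /or4P[]/eqP->; rewrite rmorphM.
- have -> : L * (X1%:R' * X2%:R') = X1%:R' * (X2%:R' * L) by ring.
  exact: JM.
- have -> : L * (X1%:R' * X3%:R') = X1%:R' * (L * X3%:R') by ring.
  exact: JM.
- exact: JM.
(* This is (y - l)^2 - (y - 3 l)(y + l) = 4 l^2, multiplied by [L]. *)
have -> : L * ((4%:R)%:R' * (l ^+ 2)%:R') =
   L * (L * L) - (y - 3%:R * l%:R') * (X1%:R' * (X2%:R' * X3%:R')).
  by rewrite LL rmorph_nat rmorphXn /L; ring.
by apply: SpanD; [|(apply: spanN; apply: spanM)]; apply: JM.
Qed.

Lemma chord_lreg (l : {poly K}) (x1 x2 x3 : K) :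
  w - l ^+ 2 = ('X - x1%:P) * ('X - x2%:P) * ('X - x3%:P) ->
  GRing.lreg (y - l%:R').
Proof.
move=> wE; apply: coord_norm_lreg; rewrite /coord_norm /= sub0r subr0 sqrrN.
by rewrite expr1n mul1r -opprB wE oppr_eq0 !mulf_neq0 // polyXsubC_eq0.
Qed.

End PointIdeals.

(** * The group law *)

Lemma span_scale (R : comNzRingType) (f : R) s x :
  ideal_span (scaleideal f s) x -> exists2 h, ideal_span s h & x = f * h.
Proof.
elim=> [|x1 x2 _ [h1 s1 ->] _ [h2 s2 ->]|c _ /mapP[g gs ->]].
- by exists 0; [apply: Span0 | rewrite mulr0].
- by exists (h1 + h2); [apply: SpanD | rewrite mulrDr].
by exists (c * g); [apply: SpanZ | rewrite mulrCA].
Qed.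

Lemma mulidealACA (R : comNzRingType) (s t u v : seq R) :
  mulideal (mulideal s t) (mulideal u v) =i
  mulideal u (mulideal s (mulideal t v)).
Proof.
move=> z; apply/mulidealP/mulidealP.
  case=> [_ [_ [/mulidealP[f [g [fs gt ->]]] /mulidealP[h [k [hu kv ->]]] ->]]].
  exists h, (f * (g * k)); split=> //; last by ring.
  by apply/mulidealP; exists f, (g * k); split=> //; apply/mulidealP;
    exists g, k.
case=> [h [_ [hu /mulidealP[f [_ [fs /mulidealP[g [k [gt kv ->]]] ->]]] ->]]].
exists (f * g), (h * k); split; last by ring.
  by apply/mulidealP; exists f, g.
by apply/mulidealP; exists h, k.
Qed.

Section GroupLaw.

Variables (K : closedFieldType) (a b : K).
Hypotheses (two_neq0 : 2%:R != 0 :> K)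
           (smooth : 4%:R * a ^+ 3 + 27%:R * b ^+ 2 != 0).

Local Notation R := (coord_ring a b).
Local Notation w := (cubic a b).
Local Notation on := (on_curve a b).
Local Notation add := (ec_add a).
Local Notation pideal := (@point_ideal K a b).
Local Notation "I ** J" := (mulideal I J) (at level 40).

Definition ec_opp (P : point K) : point K :=
  if P is Some (x, y) then Some (x, - y) else None.

Lemma on_curve_opp P : on P -> on (ec_opp P).
Proof. by case: P => [[x y]|] //=; rewrite sqrrN. Qed.

Lemma on_curveE x y : on (Some (x, y)) = (y ^+ 2 == w.[x]).
Proof. by rewrite /cubic !hornerE. Qed.

(** Chords and tangents are treated together: the line through the two points, tangent if they
    coincide, meets the curve again at [x3], and the sum is the reflection of that third point. *)
Lemma ec_add_chord (x1 y1 x2 y2 : K) :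
  on (Some (x1, y1)) -> on (Some (x2, y2)) -> ~~ ((x1 == x2) && (y1 == - y2)) ->
  exists m c x3, let l := m%:P * 'X + c%:P in [/\ l.[x1] = y1, l.[x2] = y2,
    w - l ^+ 2 = ('X - x1%:P) * ('X - x2%:P) * ('X - x3%:P) &
    add (Some (x1, y1)) (Some (x2, y2)) = Some (x3, - l.[x3])].
Proof.
move=> /eqP on1 /eqP on2 nopp.
rewrite /ec_add (negPf nopp).
set m := if _ then _ else _.
(* Both slopes satisfy these relations. The second is the difference of the two curve equations
   divided by [x2 - x1] for a chord, and the definition of the slope for a tangent. Below, the two
   cases no longer differ. *)
have [y2E aE] : y2 = y1 + m * (x2 - x1) /\
                a = m * (y1 + y2) - (x1 ^+ 2 + x1 * x2 + x2 ^+ 2).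
  rewrite /m; have [x12|x12] := eqVneq x1 x2; last first.
    have d0 : x2 - x1 != 0 by rewrite subr_eq0 eq_sym.
    have md : (y2 - y1) / (x2 - x1) * (x2 - x1) = y2 - y1 by rewrite divfK.
    split; first by rewrite md addrC subrK.
    apply: (mulfI d0); rewrite mulrBr mulrA [_ * (_ / _)]mulrC md.
    have -> : (y2 - y1) * (y1 + y2) = y2 ^+ 2 - y1 ^+ 2 by ring.
    by rewrite on1 on2; ring.
  rewrite -x12 in on2 nopp *; rewrite subrr mulr0 addr0.
  have y12 : y1 = y2.
    have /eqP := etrans on1 (esym on2); rewrite eqf_sqr eqxx /= in nopp *.
    by rewrite (negPf nopp) orbF => /eqP.
  split=> //; rewrite -y12 in nopp *; rewrite eqxx /= in nopp.
  have y10 : 2%:R * y1 != 0.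
    by move: nopp; rewrite -addr_eq0 -mulr2n mulr_natl.
  by rewrite -[y1 + y1]mulr2n -[y1 *+ 2]mulr_natl divfK //; ring.
move: m y2E aE => m y2E aE.
have bE : b = y1 ^+ 2 - x1 ^+ 3 - a * x1 by rewrite on1; ring.
exists m, (y1 - m * x1), (m ^+ 2 - x1 - x2).
split; rewrite ?(hornerD, hornerM, hornerC, hornerX).
- by ring.
- by rewrite [RHS]y2E; ring.
- rewrite /cubic bE aE y2E; ring.
by congr (Some (_, _)); ring.
Qed.

Lemma on_curve_add P Q : on P -> on Q -> on (add P Q).
Proof.
case: P Q => [[x1 y1]|] [[x2 y2]|] // on1 on2.
case H : ((x1 == x2) && (y1 == - y2)); first by rewrite /ec_add H.
have [m [c [x3 [_ _ wE ->]]]] := ec_add_chord on1 on2 (negbT H).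
set l := _ + c%:P in wE *.
have : (w - l ^+ 2).[x3] = 0 by rewrite wE hornerM hornerXsubC subrr mulr0.
rewrite hornerD hornerN horner_exp on_curveE sqrrN eq_sym -subr_eq0.
by move/eqP.
Qed.

Lemma vertical_lreg x0 : GRing.lreg (coord_poly a b ('X - x0%:P)).
Proof.
apply: coord_norm_lreg; rewrite /coord_norm /= expr0n mul0r subr0.
by rewrite expf_neq0 // polyXsubC_eq0.
Qed.

Lemma point_ideal_oppC P : on P ->
  same_class (pideal P ** pideal (ec_opp P)) [:: 1].
Proof.
case: P => [[x y]|] onP /=; last by rewrite mulideal1 scaleideal1;
  exact/eqideal_class/eqideal_refl.
by apply: (same_class_principal (vertical_lreg (x0 := x)));
  apply: point_ideal_opp.
Qed.

Lemma mulideal1r s : mulideal s [:: 1 : R] =i s.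
Proof. by move=> x; rewrite mulidealC mulideal1 scaleideal1. Qed.

Lemma same_class_mulr s t : same_class t [:: 1] ->
  same_class (s ** t) (s : seq R).
Proof.
move=> t1; apply: same_class_trans (same_class_mul (eqideal_class
  (eqideal_refl _)) t1) _.
exact/eqideal_class/eqideal_mem/mulideal1r.
Qed.

(** The points P, Q and -(P + Q) lie on a line, so the product of their ideals is principal, and the
    ideals of P + Q and -(P + Q) have inverse classes. *)
Lemma point_ideal_add P Q : on P -> on Q ->
  same_class (pideal P ** pideal Q) (pideal (add P Q)).
Proof.
case: P Q => [[x1 y1]|] [[x2 y2]|] // on1 on2; last first.
- by rewrite /= mulideal1 scaleideal1; apply/eqideal_class/eqideal_refl.
- by rewrite /= mulideal1 scaleideal1; apply/eqideal_class/eqideal_refl.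
- exact/eqideal_class/eqideal_mem/mulideal1r.
case H : ((x1 == x2) && (y1 == - y2)).
  rewrite /ec_add H; move: H => /andP[/eqP x12 /eqP y12].
  have := @point_ideal_oppC (Some (x1, y1)) on1.
  by rewrite /ec_opp x12 {2}y12 opprK.
have := on_curve_add on1 on2.
have [m [c [x3 []]]] := ec_add_chord on1 on2 (negbT H).
move: (m%:P * 'X + c%:P) => l ly1 ly2 wE ->.
set S := Some (x3, - _) => onS.
have oppS : ec_opp S = Some (x3, l.[x3]) by rewrite /= opprK.
have PQS : same_class (pideal (Some (x1, y1)) **
    (pideal (Some (x2, y2)) ** pideal (ec_opp S))) [:: 1].
  have := point_ideal_chord two_neq0 smooth wE; rewrite ly1 ly2 -oppS.
  exact/same_class_principal/(chord_lreg wE).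
apply: same_class_trans.
  exact/same_class_sym/same_class_mulr/(point_ideal_oppC onS).
apply: same_class_trans (same_class_mulr _ PQS).
apply: eqideal_class; apply: eqideal_mem => x.
exact: mulidealACA.
Qed.

(** A generator [h] would have a norm dividing those of [X - x0] and [y - y0], of degrees 2 and 3.
    That norm vanishes at [x0] and cannot have degree 1, so it has degree 2; then the cofactor [d]
    has a norm of degree 1, which is impossible. *)
Lemma point_ideal_not_principal x0 y0 : on (Some (x0, y0)) ->
  ~ same_class (pideal (Some (x0, y0))) [:: 1].
Proof.
move=> onS [f [g [rf rg [fg gf]]]].
set X := coord_poly a b ('X - x0%:P).
set Y : R := coord_y a b - coord_poly a b y0%:P.
have g1 : g \in scaleideal g [:: 1] by rewrite inE mulr1.
have [h hS gE] := span_scale (gf g g1).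
have quot k : k \in [:: X; Y] -> exists c, k = c * h.
  move=> kP; have [c _] := span_scale (fg (f * k) (map_f _ kP)).
  rewrite gE -mulrA => /rf ->; exists c; exact: mulrC.
have [c cE] : exists c, X = c * h by apply: quot; rewrite mem_head.
have [d dE] : exists d, Y = d * h by apply: quot; rewrite !inE eqxx orbT.
(* As [h] lies in the ideal, it vanishes at [(x0, y0)], and its norm is [h] times its conjugate on
   the curve. *)
have h_root : root (coord_norm h) x0.
  have on0 : y0 ^+ 2 = w.[x0] by apply/eqP; rewrite -on_curveE.
  have hval : h.1.[x0] + h.2.[x0] * y0 = 0.
    move: hS; elim=> [|k1 k2 _ IH1 _ IH2|[u v] k].
    - by rewrite /= !horner0 mul0r addr0.
    - by rewrite /= !hornerD mulrDl addrACA IH1 IH2 addr0.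
    rewrite !inE => /orP[]/eqP-> /=; rewrite !hornerE.
      by rewrite subrr !mulr0 !mul0r !addr0 ?mul0r.
    by rewrite -(eqP onS); ring.
  rewrite rootE /coord_norm hornerD hornerN (hornerM (_ ^+ 2)) !horner_exp
    -on0 -exprMn.
  by rewrite subr_sqr hval mulr0.
have Nc : coord_norm c * coord_norm h = ('X - x0%:P) ^+ 2.
  by rewrite -coord_normM -cE /coord_norm /= expr0n mul0r subr0.
have Nd : coord_norm d * coord_norm h = (y0 ^+ 2)%:P - w.
  rewrite -coord_normM -dE /coord_norm /= sub0r subr0 sqrrN expr1n mul1r.
  by rewrite rmorphXn.
have sX : size (('X - x0%:P) ^+ 2) = 3%N by rewrite size_exp_XsubC.
have sY : size ((y0 ^+ 2)%:P - w) = 4%N.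
  by rewrite addrC size_polyDl size_polyN size_cubic //
    ltnS (leq_trans (size_polyC_leq1 _)).
have [Nc0 Nh0] : coord_norm c != 0 /\ coord_norm h != 0.
  by apply/andP; rewrite -negb_or -mulf_eq0 Nc -size_poly_eq0 sX.
have Nd0 : coord_norm d != 0.
  by apply/eqP => N0; move: sY; rewrite -Nd N0 mul0r size_poly0.
move: sX sY; rewrite -Nc -Nd !size_mul //.
have := coord_norm_size c; have := coord_norm_size d; have := coord_norm_size h.
have := root_size_gt1 Nh0 h_root.
move: Nc0; rewrite -size_poly_gt0.
move: (size (coord_norm h)) (size (coord_norm c)) (size (coord_norm d)).
by clear=> nh nc nd; lia.
Qed.

Lemma ec_add_opp P Q : add P (ec_opp Q) = None -> P = Q.
Proof.
case: P Q => [[x y]|] [[x' y']|] //=; rewrite opprK.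
by case: ifP => // /andP[/eqP-> /eqP->].
Qed.

(** Equal classes make the class of P - Q trivial, and an affine point has a nontrivial class, so P
    - Q is the point at infinity. *)
Lemma point_ideal_inj P Q : on P -> on Q ->
  same_class (pideal P) (pideal Q) -> P = Q.
Proof.
move=> onP onQ PQ; apply: ec_add_opp.
have onQ' := on_curve_opp onQ.
have := on_curve_add onP onQ'.
have : same_class (pideal (add P (ec_opp Q))) [:: 1].
  apply: same_class_trans (same_class_sym (point_ideal_add onP onQ')) _.
  apply: same_class_trans (point_ideal_oppC onQ).
  by apply: same_class_mul PQ _; apply/eqideal_class/eqideal_refl.
by case: (add _ _) => [[x y]|] // S1 /point_ideal_not_principal[].
Qed.

(** Commutativity, and associativity below, are inherited from the product of ideals through the
    injective class map. *)
Lemma ec_addC P Q : on P -> on Q -> add P Q = add Q P.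
Proof.
move=> onP onQ; apply: point_ideal_inj; try exact: on_curve_add.
apply: same_class_trans (point_ideal_add onQ onP).
apply: same_class_trans (same_class_sym (point_ideal_add onP onQ)) _.
exact/eqideal_class/eqideal_mem/mulidealC.
Qed.

Lemma ec_addA P Q S : on P -> on Q -> on S ->
  add P (add Q S) = add (add P Q) S.
Proof.
move=> onP onQ onS; have onPQ := on_curve_add onP onQ.
have onQS := on_curve_add onQ onS.
apply: point_ideal_inj; try exact: on_curve_add.
apply: same_class_trans (same_class_sym (point_ideal_add onP onQS)) _.
apply: same_class_trans (point_ideal_add onPQ onS).
have refl T : same_class (pideal T) (pideal T) by
  apply/eqideal_class/eqideal_refl.
apply: same_class_trans (same_class_mul (refl P) (same_class_sym
  (point_ideal_add onQ onS))) _.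
apply: same_class_trans _ (same_class_mul (point_ideal_add onP onQ) (refl S)).
exact/eqideal_class/eqideal_mem/mulidealA.
Qed.

End GroupLaw.

(** * The curve as an abelian group *)

Section CurveGroup.

Variables (K : closedFieldType) (a b : K).

(* The proofs are arguments of the type because its group structure needs
  them. *)
Definition curve (two_neq0 : 2%:R != 0 :> K)
    (smooth : 4%:R * a ^+ 3 + 27%:R * b ^+ 2 != 0) : Type :=
  {P : point K | on_curve a b P}.

Hypotheses (two_neq0 : 2%:R != 0 :> K)
           (smooth : 4%:R * a ^+ 3 + 27%:R * b ^+ 2 != 0).

Local Notation E := (curve two_neq0 smooth).

HB.instance Definition _ := SubChoice.on E.

Definition curve_zero : E :=
  exist (fun P => on_curve a b P) None isT.
Definition curve_opp (P : E) : E := 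
  exist (fun P => on_curve a b P) _ (on_curve_opp (valP P)).
Definition curve_add (P Q : E) : E :=
  exist (fun P => on_curve a b P) _ (on_curve_add (valP P) (valP Q)).

Fact curve_addA : associative curve_add.
Proof.
by move=> P Q S; apply: val_inj;
  exact: (ec_addA two_neq0 smooth (valP P) (valP Q) (valP S)).
Qed.
Fact curve_addC : commutative curve_add.
Proof.
by move=> P Q; apply: val_inj;
  exact: (ec_addC two_neq0 smooth (valP P) (valP Q)).
Qed.
Fact curve_add0 : left_id curve_zero curve_add.
Proof. by move=> P; apply: val_inj. Qed.
Fact curve_addN : left_inverse curve_zero curve_opp curve_add.
Proof.
by move=> [[[x y]|] onP]; apply: val_inj => //=; rewrite !eqxx.
Qed.

HB.instance Definition _ := GRing.isZmodule.Build E
  curve_addA curve_addC curve_add0 curve_addN.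

End CurveGroup.

(** * Resultants *)

Section TopCoefficients.

Variable R : comNzRingType.

Lemma coefM_top (p q : {poly R}) m n :
  (size p <= m.+1)%N -> (size q <= n.+1)%N ->
  (size (p * q)%R <= (m + n).+1)%N /\ (p * q)`_(m + n) = p`_m * q`_n.
Proof.
move=> sp sq; split.
  by apply: leq_trans (size_polyMleq _ _) _; lia.
have mlt : (m < (m + n).+1)%N by lia.
rewrite coefM (bigD1 (Ordinal mlt)) //= addKn big1 ?addr0 // => i /eqP im.
have {}im : nat_of_ord i <> m by move=> /(@val_inj _ _ _ i (Ordinal mlt)).
have [lt|ge] := ltnP i m; first by rewrite [q`__]nth_default ?mulr0 //;
  apply: leq_trans sq _; lia.
by rewrite nth_default ?mul0r //; apply: leq_trans sp _; lia.
Qed.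

Lemma coef_prod_top (I : finType) (p : I -> {poly R}) (e : I -> nat) :
  (forall i, (size (p i) <= (e i).+1)%N) ->
  (size (\prod_i p i)%R <= (\sum_i e i).+1)%N /\
  (\prod_i p i)`_(\sum_i e i) = \prod_i (p i)`_(e i).
Proof.
move=> pe; elim: (index_enum I) => [|i s [IHs IHc]].
  by rewrite !big_nil coef1 size_poly1.
rewrite !big_cons -IHc; exact: coefM_top.
Qed.

(** Every term of the determinant takes one entry from each row, so the formal degrees [e] of the
    rows add up, and top coefficients can be taken entry by entry. *)
Lemma coef_det_top n (M : 'M[{poly R}]_n) (e : 'I_n -> nat) :
  (forall i j, (size (M i j) <= (e i).+1)%N) ->
  (size (\det M) <= (\sum_i e i).+1)%N /\
  (\det M)`_(\sum_i e i) = \det (\matrix_(i, j) (M i j)`_(e i)).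
Proof.
move=> Me; rewrite /determinant coef_sum; split.
  apply: leq_trans (size_sum _ _ _) _; apply/bigmax_leqP => s _.
  have [le _] := coef_prod_top (fun i => Me i (s i)).
  by rewrite mulr_sign; case: ifP; rewrite ?size_polyN.
apply: eq_bigr => s _; have [_] := coef_prod_top (fun i => Me i (s i)).
rewrite !mulr_sign => E.
have -> : \prod_i (\matrix_(i, j) (M i j)`_(e i)) i (s i) =
          \prod_i (M i (s i))`_(e i) by apply: eq_bigr => i _; rewrite mxE.
by rewrite -E; case: ifP; rewrite ?coefN.
Qed.

End TopCoefficients.

Section FormalSylvester.

Variable R : comNzRingType.

(* The Sylvester matrix of sum_(j <= m) p_j z^j and sum_(j <= n) q_j z^j, where
   p_m and q_n are allowed to vanish. *)
Definition sylvester m n (p q : nat -> R) : 'M[R]_(n + m) :=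
  \matrix_(i, j)
    match split i with
    | inl k => p (j - k)%N *+ ((k <= j) && (j <= k + m))%N
    | inr k => q (j - k)%N *+ ((k <= j) && (j <= k + n))%N
    end.

Lemma resultant_sylvester m n (p q : {poly R}) :
  size p = m.+1 -> size q = n.+1 ->
  resultant p q = \det (sylvester m n (fun j => p`_j) (fun j => q`_j)).
Proof.
move=> sp sq; have [-> ->] : m = (size p).-1 /\ n = (size q).-1 by rewrite sp
  sq.
congr (\det _); apply/matrixP => i j; rewrite Sylvester_mxE mxE.
have coef0 (r : {poly R}) (k l : nat) : 
    r`_(l - k) *+ (k <= l)%N = r`_(l - k) *+ ((k <= l) && (l <= k + (size
      r).-1))%N.
  case kl : (k <= l)%N => //=; case: leqP => //= lt.
  by rewrite nth_default //; lia.
by case: split => k; apply: coef0.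
Qed.

End FormalSylvester.

(** The polynomials are viewed as binary forms of degrees [m] and [n]; the vanishing of both top
    coefficients is a common root at infinity. *)
Lemma det_sylvester_eq0 (K : closedFieldType) m n (p q : {poly K}) :
  (size p <= m.+1)%N -> (size q <= n.+1)%N -> (0 < m)%N -> (0 < n)%N ->
  \det (sylvester m n (fun j => p`_j) (fun j => q`_j)) = 0 <->
  (exists z, p.[z] = 0 /\ q.[z] = 0) \/ (p`_m = 0 /\ q`_n = 0).
Proof.
move=> sp sq m0 n0; set S := sylvester _ _ _ _.
(* The row space consists of the combinations u p + v q with deg u < n and deg v < m. If p and q are
   coprime and one top coefficient is nonzero, divisibility leaves only the zero relation. *)
have Srow (u : 'rV_n) (v : 'rV_m) :
    row_mx u v *m S = poly_rV (rVpoly u * p + rVpoly v * q).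
  have -> : S = col_mx (lin1_mx (poly_rV \o p \o* rVpoly))
                       (lin1_mx (poly_rV \o q \o* rVpoly)).
    have top0 (r : {poly K}) (d k l : nat) : (size r <= d.+1)%N ->
        r`_(l - k) *+ ((k <= l) && (l <= k + d))%N = r`_(l - k) *+ (k <= l)%N.
      move=> sr; case kl : (k <= l)%N => //=; case: leqP => //= lt.
      by rewrite nth_default //; apply: leq_trans sr _; lia.
    apply/matrixP => i j; rewrite !mxE.
    by case: split => k; rewrite !mxE /= rVpoly_delta coefXnM top0 //
      ltnNge if_neg -mulrb.
  by rewrite mul_row_col !mul_rV_lin1 /= -linearD.
have size_rV d (u : 'rV[K]_d) : (size (rVpoly u) <= d)%N by exact: size_poly.
have size_comb (u : 'rV_n) (v : 'rV_m) d e : (size p <= d)%N ->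
  (size q <= e)%N ->
    (size (rVpoly u * p + rVpoly v * q)%R <= maxn (n + d).-1 (m + e).-1)%N.
  move=> pd qe; have su := size_rV _ u; have sv := size_rV _ v.
  apply: leq_trans (size_polyD _ _) _; rewrite geq_max !leq_max.
  by apply/andP; split; apply/orP; [left | right];
     apply: leq_trans (size_polyMleq _ _) _; lia.
split=> [/eqP/det0P[w w0]|].
  rewrite -[w]hsubmxK in w0 *; set u := lsubmx w in w0 *;
    set v := rsubmx w in w0 *.
  rewrite Srow => /(congr1 rVpoly).
  rewrite poly_rV_K ?linear0 => [E|]; last first.
    by apply: leq_trans (size_comb _ _ _ _ sp sq) _; rewrite geq_max; lia.
  have [cop|/closed_rootP[z]] := eqVneq (size (gcdp p q)) 1%N; last first.
    rewrite root_gcd => /andP[/rootP pz /rootP qz]; left; exists z; split => //.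
  have cop' : coprimep p q by apply/eqP.
  have dvd_lt (r t : {poly K}) d : (size t <= d)%N -> (size r <= d.+1)%N ->
      r %| t -> r`_d != 0 -> t = 0.
    move=> st sr rt rd; apply: contraTeq rd => t0; rewrite negbK nth_default //.
    exact: leq_trans (dvdp_leq t0 rt) st.
  have rV0 d (x : 'rV[K]_d) : rVpoly x = 0 -> x = 0.
    by move=> x0; rewrite -[x]rVpolyK x0 linear0.
  have up : rVpoly u * p = - (rVpoly v * q) by apply/eqP; rewrite -addr_eq0 E.
  right; split; apply: contraNeq w0 => top.
    have v0 : rVpoly v = 0.
      apply: dvd_lt (size_rV _ _) sp _ top.
      rewrite -(Gauss_dvdpl _ cop') -dvdpNr -up dvdp_mull //.
    have : rVpoly u * p = 0 by rewrite up v0 mul0r oppr0.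
    move=> /eqP; rewrite mulf_eq0 => /orP[/eqP/rV0->|/eqP p0].
      by rewrite (rV0 _ _ v0) row_mx0.
    by rewrite p0 coef0 eqxx in top.
  have u0 : rVpoly u = 0.
    apply: dvd_lt (size_rV _ _) sq _ top.
    by rewrite coprimep_sym in cop';
      rewrite -(Gauss_dvdpl _ cop') up dvdpNr dvdp_mull.
  have : rVpoly v * q = 0 by rewrite -[LHS]opprK -up u0 mul0r oppr0.
  move=> /eqP; rewrite mulf_eq0 => /orP[/eqP/rV0->|/eqP q0].
    by rewrite (rV0 _ _ u0) row_mx0.
  by rewrite q0 coef0 eqxx in top.
have Scol (c : 'cV_(n + m)) : c != 0 ->
    (forall (u : 'rV_n) (v : 'rV_m),
      poly_rV (rVpoly u * p + rVpoly v * q) *m c = 0) -> \det S = 0.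
  move=> c0 Sc; rewrite -det_tr; apply/eqP/det0P; exists c^T.
    by rewrite trmx_eq0.
  rewrite -trmx_mul; apply/eqP; rewrite trmx_eq0; apply/eqP/row_matrixP => i.
  by rewrite row_mul rowE -[delta_mx _ _]hsubmxK Srow Sc row0.
have ij : (0 < n + m)%N by lia.
(* A common root z puts the column of powers of z in the kernel. A common root at infinity puts the
   last basis vector there, as no combination then reaches the last degree. *)
case=> [[z [pz qz]]|[pm qn]].
  apply: (Scol (\col_j z ^+ j)) => [|u v].
    apply/eqP => /matrixP/(_ (Ordinal ij) 0); rewrite !mxE expr0 => /eqP.
    by rewrite oner_eq0.
  apply/matrixP => i j; rewrite !mxE.
  transitivity (rVpoly u * p + rVpoly v * q).[z]; last first.
    by rewrite hornerD !hornerM pz qz !mulr0 addr0.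
  rewrite (@horner_coef_wide _ (n + m)).
    by apply: eq_bigr => k _; rewrite !mxE.
  by apply: leq_trans (size_comb _ _ _ _ sp sq) _; rewrite geq_max; lia.
have lst : ((n + m).-1 < n + m)%N by lia.
apply: (Scol (delta_mx (Ordinal lst) 0)) => [|u v].
  apply/eqP => /matrixP/(_ (Ordinal lst) 0); rewrite !mxE !eqxx => /eqP.
  by rewrite oner_eq0.
rewrite -colE; apply/matrixP => i j; rewrite !mxE nth_default //=.
have lower d (r : {poly K}) : (size r <= d.+1)%N -> r`_d = 0 -> (size r <= d)%N.
  move=> sr rd; apply/leq_sizeP => k; rewrite leq_eqVlt => /orP[/eqP<-//|dk].
  by rewrite nth_default //; apply: leq_trans sr dk.
apply: leq_trans (size_comb _ _ _ _ (lower _ _ sp pm) (lower _ _ sq qn)) _.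
by rewrite geq_max; lia.
Qed.

Lemma poly_vanish (K : closedFieldType) (p : {poly K}) :
  (forall z, p.[z] = 0) -> p = 0.
Proof.
move=> p0; apply/eqP/negPn/negP => /closed_nonrootP[z /negP[]].
by rewrite rootE p0.
Qed.

(** For fixed i >= N, the i-th coefficient of [P.[z%:P]] is a polynomial in z that vanishes
    everywhere, hence is zero. *)
Lemma size_coef_bound (K : closedFieldType) (P : {poly {poly K}}) N :
  (forall z : K, (size P.[z%:P]%R <= N)%N) -> forall j, (size (P`_j)%R <= N)%N.
Proof.
move=> PN j; apply/leq_sizeP => i Ni.
have : map_poly (fun q : {poly K} => q`_i) P = 0.
  apply: poly_vanish => z; transitivity (P.[z%:P]`_i); last first.
    exact: (leq_sizeP _ _ (PN z)).
  rewrite (horner_coef P) coef_sum (@horner_coef_wide _ (size P)) ?size_poly //.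
  apply: eq_bigr => k _; rewrite coef_map_id0 ?coef0 // -rmorphXn /= coefMC //.
by move/polyP/(_ j); rewrite coef_map_id0 ?coef0.
Qed.

Definition extend (T : Type) c (Z : 'I_c -> T) (w : T) : 'I_c.+1 -> T :=
  fun i => if unlift ord_max i is Some j then Z j else w.

Lemma extend_lift (T : Type) c (Z : 'I_c -> T) w j :
  extend Z w (lift ord_max j) = Z j.
Proof. by rewrite /extend liftK. Qed.

Lemma extend_max (T : Type) c (Z : 'I_c -> T) w : extend Z w ord_max = w.
Proof. by rewrite /extend unlift_none. Qed.

Lemma eq_mmap (R : nzRingType) (S : nzRingType) n (phi psi : {rmorphism R -> S})
    (h k : 'I_n -> S) (f : {mpoly R[n]}) :
  phi =1 psi -> h =1 k -> mmap phi h f = mmap psi k f.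
Proof.
by move=> pp hk; apply: eq_bigr => m _; rewrite pp (mmap1_eq _ hk).
Qed.

Lemma rmorph_mmap (R : nzRingType) (S T : comNzRingType) n
    (phi : {rmorphism R -> S}) (psi : {rmorphism S -> T}) (h : 'I_n -> S)
    (f : {mpoly R[n]}) :
  psi (mmap phi h f) = mmap (psi \o phi) (psi \o h) f.
Proof.
rewrite rmorph_sum; apply: eq_bigr => m _; rewrite rmorphM rmorph_prod.
by congr (_ * _); apply: eq_bigr => i _; rewrite rmorphXn.
Qed.

Lemma horner_subst_last (F : fieldType) (S : comNzRingType) c m
    (s : 'I_c -> 'I_m) (g : {mpoly F[c.+1]})
    (phi : {rmorphism {mpoly F[m]} -> S}) (x : S) :
  (map_poly phi (subst_last s g)).[x] =
  mmap (phi \o @mpolyC m F) (extend (fun i => phi 'X_(s i)) x) g.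
Proof.
rewrite -[LHS]/((horner_eval x \o map_poly phi) (subst_last s g)).
rewrite rmorph_mmap; apply: eq_mmap => [c0|i] /=.
  by rewrite map_polyC /horner_eval hornerC.
by rewrite /extend; case: unlift => [j|];
  rewrite ?map_polyX ?map_polyC /horner_eval ?hornerC ?hornerX.
Qed.

Lemma mmap_id (R : nzRingType) n (f : {mpoly R[n]}) :
  mmap (@mpolyC n R) (fun i => 'X_i) f = f.
Proof.
rewrite [RHS]mpolyE; apply: eq_bigr => m _.
by rewrite mmap1_id mul_mpolyC.
Qed.

Lemma mpoly_vanish (K : closedFieldType) n (f : {mpoly K[n]}) :
  (forall v, f.@[v] = 0) -> f = 0.
Proof.
elim: n f => [|n IHn] f f0.
  have := f0 (fun=> 0); rewrite [f]nvar0_mpolyC mevalC => ->.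
  exact: mpolyC0.
have G0 : subst_last id f = 0.
  apply/polyP => j; rewrite coef0; apply: IHn => v.
  have : map_poly (meval v) (subst_last id f) = 0.
    apply: poly_vanish => z; rewrite horner_subst_last.
    rewrite -[RHS](f0 (extend v z)); apply: eq_mmap => [c|i] /=;
      first by rewrite mevalC.
    by rewrite /extend; case: unlift => // k; rewrite mevalXU.
  by move/polyP/(_ j); rewrite coef_map coef0.
(* Evaluating [subst_last id f] at the last variable gives back [f]. *)
have := horner_subst_last id f
  (mmap (@mpolyC n.+1 K) (fun j => 'X_(lift ord_max j))) 'X_ord_max.
rewrite G0 map_poly0 horner0 => E.
rewrite -[f]mmap_id [RHS]E; apply: eq_mmap => [c|i] /=; first by rewrite mmapC.
rewrite /extend; case: unliftP => [j|] -> //.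
by rewrite mmapX mmap1U.
Qed.

(** * Specialization at points of the projective line *)

Section Specialization.

Variables (F : fieldType) (K : closedFieldType) (iota : {rmorphism F -> K}).

Definition proj_coord (w : option K) : {poly K} :=
  if w is Some z then z%:P else 'X.

(* Specializing at Z, a tuple of points of the projective line: the variables
   at infinity all become 'X, so that for f of degree at most D in each
   variable the coefficient of 'X^(D * n_infty Z) in [specialize Z f] is the
   value at Z of the multihomogenization of f. *)
Definition specialize m (Z : 'I_m -> option K) : {mpoly F[m]} -> {poly K} :=
  mmap (polyC \o iota) (fun i => proj_coord (Z i)).

HB.instance Definition _ m (Z : 'I_m -> option K) :=
  GRing.RMorphism.on (specialize Z).

Definition n_infty m (Z : 'I_m -> option K) : nat :=
  (\sum_i (Z i == None : nat))%N.

(** [V] is the zero set, in a product of projective lines, of the multihomogenization of [f] to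
    degree [D] in each variable. *)
Definition vanishes_on m D (f : {mpoly F[m]}) (V : ('I_m -> option K) ->
  Prop) :=
  forall Z, (size (specialize Z f) <= (n_infty Z * D).+1)%N /\
    ((specialize Z f)`_(n_infty Z * D) = 0 <-> V Z).

Lemma n_infty_extend c (Z : 'I_c -> option K) w :
  n_infty (extend Z w) = ((w == None) + n_infty Z)%N.
Proof.
rewrite /n_infty (bigD1_ord ord_max) //= extend_max; congr addn.
by apply: eq_bigr => i _; rewrite extend_lift.
Qed.

Lemma n_infty_Some m (v : 'I_m -> K) : n_infty (fun i => Some (v i)) = 0%N.
Proof. by rewrite /n_infty big1. Qed.

Lemma specialize_Some m (v : 'I_m -> K) (f : {mpoly F[m]}) :
  specialize (fun i => Some (v i)) f = ((map_mpoly iota f).@[v])%:P.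
Proof.
rewrite /meval /map_mpoly !rmorph_mmap; apply: eq_mmap => [x|i] /=.
  by rewrite mmapC.
by rewrite mmapX mmap1U.
Qed.

Lemma specialize_vanish m (f : {mpoly F[m]}) :
  (forall v : 'I_m -> K, specialize (fun i => Some (v i)) f = 0) -> f = 0.
Proof.
move=> f0; have /mpolyP E : map_mpoly iota f = 0.
  apply: mpoly_vanish => v; apply/eqP; rewrite -polyC_eq0.
  by rewrite -specialize_Some f0.
apply/mpolyP => m0; have := E m0; rewrite mcoeff_map_mpoly !mcoeff0.
by move/eqP; rewrite fmorph_eq0 => /eqP.
Qed.

Lemma specialize_subst_last c m (s : 'I_c -> 'I_m) (g : {mpoly F[c.+1]}) Z w :
  (map_poly (specialize Z) (subst_last s g)).[proj_coord w] =
  specialize (extend (fun i => Z (s i)) w) g.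
Proof.
rewrite horner_subst_last; apply: eq_mmap => [x|i] /=; first exact: mmapC.
by rewrite /extend; case: unlift => [j|] //; rewrite /specialize mmapX mmap1U.
Qed.

(** * Dependence on the last variable *)

Section Fiber.

Variables (c m D : nat) (s : 'I_c -> 'I_m) (g : {mpoly F[c.+1]}).
Variable V : ('I_c.+1 -> option K) -> Prop.
Hypothesis gV : vanishes_on D g V.

Local Notation G := (subst_last s g).
Local Notation k Z := (n_infty (fun i => Z (s i))).

Lemma fiber_coef_size Z j : (size (specialize Z G`_j) <= (k Z * D).+1)%N.
Proof.
rewrite -coef_map; apply: size_coef_bound => z.
rewrite -[z%:P]/(proj_coord (Some z)) specialize_subst_last.
by have [+ _] := gV (extend (fun i => Z (s i)) (Some z));
  rewrite n_infty_extend.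
Qed.

(** At a tuple of finite values the coefficients in z are constants, so sending z to infinity
    reveals the degree in z, which the size bound of [vanishes_on] limits to [D]. *)
Lemma fiber_size : (size G <= D.+1)%N.
Proof.
apply/leq_sizeP => j Dj; apply: specialize_vanish => v.
set Z := fun i => Some (v i); have k0 : k Z = 0%N by exact: n_infty_Some.
set P := map_poly (specialize Z) G.
have Pi i : (size (P`_i)%R <= 1)%N.
  by rewrite coef_map; have := fiber_coef_size Z i; rewrite k0.
pose Q := map_poly (fun q : {poly K} => q`_0) P.
have Qi i : Q`_i = P`_i`_0 by rewrite coef_map_id0 ?coef0.
have PE : P = map_poly polyC Q.
  by apply/polyP => i; rewrite (coef_map polyC) /= Qi -size1_polyC.
have [+ _] := gV (extend (fun i => Z (s i)) None).
rewrite -specialize_subst_last n_infty_extend k0 mul1n -/P /= PE.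
rewrite -[_.['X]]/(_ \Po 'X) comp_polyXr => /leq_sizeP/(_ j Dj).
rewrite Qi coef_map => q0.
by rewrite [LHS]size1_polyC ?q0 //; have := fiber_coef_size Z j; rewrite k0.
Qed.

(** The multihomogenization of [g] with all variables but the last fixed at [Z], as a form of degree
    [D] in the last one. *)
Definition fiber Z : {poly K} :=
  \poly_(j < D.+1) (specialize Z G`_j)`_(k Z * D).

Lemma fiber_root Z z :
  (fiber Z).[z] = 0 <-> V (extend (fun i => Z (s i)) (Some z)).
Proof.
have [_ <-] := gV (extend (fun i => Z (s i)) (Some z)).
rewrite n_infty_extend add0n -specialize_subst_last /=.
rewrite (@horner_coef_wide _ D.+1 (map_poly _ _)); last first.
  by apply: leq_trans _ fiber_size; apply: size_poly.
rewrite coef_sum horner_poly.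
under [X in _ <-> X = _]eq_bigr => j _ do rewrite coef_map -rmorphXn /= coefMC.
by [].
Qed.

Lemma fiber_top Z :
  (fiber Z)`_D = 0 <-> V (extend (fun i => Z (s i)) None).
Proof.
have [_ <-] := gV (extend (fun i => Z (s i)) None).
rewrite n_infty_extend -specialize_subst_last /= mulnDl mul1n addnC.
rewrite (@horner_coef_wide _ D.+1 (map_poly _ _)); last first.
  by apply: leq_trans _ fiber_size; apply: size_poly.
(* The summand of index [j] has degree at most [k Z * D + j], so only [j = D] contributes. *)
rewrite coef_sum big_ord_recr /= coefMXn ltnNge leq_addl /= addnK.
rewrite big1 ?add0r => [|i _]; last first.
  rewrite coefMXn; case: ifP => // _; rewrite coef_map nth_default //.
  by apply: leq_trans (fiber_coef_size _ _) _; have := ltn_ord i; lia.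
by rewrite coef_poly ltnSn coef_map.
Qed.

(** The format of [resultant] depends on actual degrees; one tuple outside [V] with last entry at
    infinity shows that the degree in z is exactly [D]. *)
Lemma fiber_size_eq Z : ~ V (extend (fun i => Z (s i)) None) -> size G = D.+1.
Proof.
move=> nV; apply/eqP; rewrite eqn_leq fiber_size ltnNge; apply/negP => GD.
by apply/nV/fiber_top; rewrite coef_poly ltnSn (nth_default 0 GD) rmorph0 coef0.
Qed.

End Fiber.

(** The Sylvester matrix has [Dh] rows of formal degree [kg * Dg] and [Dg] rows of formal degree
    [kh * Dh], which add up to [(kg + kh) * Dg * Dh], the degree required of the resultant. *)
Lemma vanishes_on_res c d Dg Dh (g : {mpoly F[c.+1]}) (h : {mpoly F[d.+1]})
  Vg Vh :
  vanishes_on Dg g Vg -> vanishes_on Dh h Vh -> (0 < Dg)%N -> (0 < Dh)%N ->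
  (exists Z : 'I_(c + d) -> option K, ~ Vg (extend (fun i =>
    Z (lshift d i)) None)) ->
  (exists Z : 'I_(c + d) -> option K, ~ Vh (extend (fun i =>
    Z (rshift c i)) None)) ->
  vanishes_on (Dg * Dh) (semaev_res g h) (fun Z : 'I_(c + d) -> option K =>
    exists w, Vg (extend (fun i => Z (lshift d i)) w) /\
              Vh (extend (fun i => Z (rshift c i)) w)).
Proof.
move=> gV hV Dg0 Dh0 [Zg nVg] [Zh nVh] Z.
have sG : size (subst_last (@lshift c d) g) = Dg.+1 by apply: (fiber_size_eq
  gV nVg).
have sH : size (subst_last (@rshift c d) h) = Dh.+1 by apply: (fiber_size_eq
  hV nVh).
rewrite /semaev_res (resultant_sylvester sG sH) -det_map_mx.
set kg := n_infty (fun i => Z (lshift d i)).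
set kh := n_infty (fun i => Z (rshift c i)).
pose e (i : 'I_(Dh + Dg)) :=
  match split i with inl _ => (kg * Dg)%N | inr _ => (kh * Dh)%N end.
have split_l k : split (lshift Dg k) = inl k :> 'I_Dh + 'I_Dg.
  by rewrite -[lshift _ _]/(unsplit (inl k)) unsplitK.
have split_r k : split (rshift Dh k) = inr k :> 'I_Dh + 'I_Dg.
  by rewrite -[rshift _ _]/(unsplit (inr k)) unsplitK.
have eE : (n_infty Z * (Dg * Dh))%N = (\sum_i e i)%N.
  have el k : e (lshift Dg k) = (kg * Dg)%N by rewrite /e split_l.
  have er k : e (rshift Dh k) = (kh * Dh)%N by rewrite /e split_r.
  have -> : n_infty Z = (kg + kh)%N by rewrite /n_infty big_split_ord.
  rewrite big_split_ord /= (eq_bigr _ (fun k _ => el k)).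
  rewrite (eq_bigr _ (fun k _ => er k)) !sum_nat_const !card_ord; ring.
set M := map_mx _ _.
have Me i j : (size (M i j) <= (e i).+1)%N.
  rewrite !mxE /e; case: split => k; rewrite rmorphMn; case: (_ && _);
    by rewrite ?mulr0n ?size_poly0 // (fiber_coef_size _ gV,
      fiber_coef_size _ hV).
have [sM cM] := coef_det_top Me; rewrite eE cM; split=> //.
(* The top coefficients form the Sylvester matrix of the two fibers, whose common roots, infinity
   included, are the values [w]. *)
have -> : \matrix_(i, j) (M i j)`_(e i) =
   sylvester Dg Dh (fun j => (fiber Dg (@lshift c d) g Z)`_j)
     (fun j => (fiber Dh (@rshift c d) h Z)`_j).
  apply/matrixP => i j; rewrite !mxE /e; case: split => k;
    rewrite rmorphMn coefMn;
    by case kj: (_ && _) => //; rewrite coef_poly ltnS leq_subLR;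
      case/andP: kj => _ ->.
rewrite det_sylvester_eq0 ?size_poly //; split.
  case=> [[z [gz hz]]|[gt ht]].
    by exists (Some z); split;
      [apply/(fiber_root _ gV) | apply/(fiber_root _ hV)].
  by exists None; split; [apply/(fiber_top _ gV) | apply/(fiber_top _ hV)].
case=> [[z|] [gw hw]]; [left; exists z | right].
  by split; [apply/(fiber_root _ gV) | apply/(fiber_root _ hV)].
by split; [apply/(fiber_top _ gV) | apply/(fiber_top _ hV)].
Qed.

End Specialization.

(** * Semaev's theorem *)

Section XCoordinates.

Variables (K : closedFieldType) (a b : K) (two_neq0 : 2%:R != 0 :> K)
  (smooth : 4%:R * a ^+ 3 + 27%:R * b ^+ 2 != 0).
Local Notation E := (curve two_neq0 smooth).
Local Notation w := (cubic a b).

Definition xcoord (P : E) : option K := omap fst (val P).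

Lemma xcoord0 : xcoord 0 = None. Proof. by []. Qed.

Lemma xcoordN P : xcoord (- P) = xcoord P.
Proof. by case: P => [[[x y]|] onP]. Qed.

Lemma xcoord_None P : xcoord P = None -> P = 0.
Proof. by case: P => [[[x y]|] onP] // _; apply: val_inj. Qed.

Lemma xcoord_eq P Q : xcoord P = xcoord Q -> P = Q \/ P = - Q.
Proof.
case: P Q => [[[x y]|] onP] [[[x' y']|] onQ] //= E; last by left;
  apply: val_inj.
case: E => E; rewrite E in onP *.
have /eqP := etrans (eqP onP) (esym (eqP onQ));
  rewrite eqf_sqr => /orP[]/eqP yy.
  by left; apply: val_inj; rewrite /= yy.
by right; apply: val_inj; rewrite /= yy.
Qed.

Lemma sqrt_ex (z : K) : exists y, y ^+ 2 = z.
Proof.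
have [|y] := @closed_rootP K ('X^2 - z%:P) _.
  by rewrite size_polyDl ?size_polyXn //
    size_polyN (leq_ltn_trans (size_polyC_leq1 _)).
by rewrite rootE !hornerE subr_eq0 => /eqP yz; exists y.
Qed.

Lemma xcoord_ex u : exists P, xcoord P = u.
Proof.
case: u => [x|]; last by exists 0.
have [y yE] := sqrt_ex (x ^+ 3 + a * x + b).
have onP : on_curve a b (Some (x, y)) by apply/eqP.
by exists (exist (fun P => on_curve a b P) _ onP).
Qed.

Lemma line_coefE m c x1 x2 x3 :
  w - (m%:P * 'X + c%:P) ^+ 2 = ('X - x1%:P) * ('X - x2%:P) * ('X - x3%:P) <->
  [/\ m ^+ 2 = x1 + x2 + x3, 2%:R * m * c = a - (x1 * x2 + x1 * x3 + x2 * x3)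
    & c ^+ 2 = b + x1 * x2 * x3].
Proof.
set e1 := x1 + _ + _; set e2 := _ + x2 * x3; set e3 := x1 * x2 * x3.
have E : w - (m%:P * 'X + c%:P) ^+ 2 - ('X - x1%:P) * ('X - x2%:P) * ('X -
  x3%:P)
    = Poly [:: b + e3 - c ^+ 2; a - e2 - 2%:R * m * c; e1 - m ^+ 2].
  by rewrite /= !cons_poly_def /cubic /e1 /e2 /e3; ring.
split.
  move/eqP; rewrite -subr_eq0 E => /eqP/polyP P0.
  have := (P0 0%N, P0 1%N, P0 2%N);
    rewrite !coef_Poly !coef0 /= => -[[p0 p1] p2].
  by split; apply/esym/eqP; rewrite -subr_eq0; apply/eqP.
case=> m1 m2 m3; apply/eqP; rewrite -subr_eq0 E m1 m2 m3 !subrr.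
by apply/eqP/polyP => -[|[|[|i]]]; rewrite coef_Poly coef0 //= nth_nil.
Qed.

Definition sum3_zero u1 u2 u3 := exists P1 P2 P3 : E,
  [/\ xcoord P1 = u1, xcoord P2 = u2, xcoord P3 = u3 & P1 + P2 + P3 = 0].

Lemma sum3_zeroC12 u1 u2 u3 : sum3_zero u1 u2 u3 <-> sum3_zero u2 u1 u3.
Proof. by split=> -[P1 [P2 [P3 [? ? ? ?]]]]; exists P2, P1, P3;
  rewrite (addrC P2). Qed.

Lemma sum3_zeroC23 u1 u2 u3 : sum3_zero u1 u2 u3 <-> sum3_zero u1 u3 u2.
Proof. by split=> -[P1 [P2 [P3 [? ? ? ?]]]]; exists P1, P3, P2;
  rewrite addrAC. Qed.

Lemma sum3_zero_NNN : sum3_zero None None None.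
Proof. by exists 0, 0, 0; rewrite !addr0. Qed.

Lemma sum3_zero_NNS z : ~ sum3_zero None None (Some z).
Proof.
by move=> [P1 [P2 [P3 [/xcoord_None-> /xcoord_None-> + ]]]];
  rewrite !add0r => + P0;
  rewrite P0 xcoord0.
Qed.

Lemma sum3_zero_NSS z1 z2 : sum3_zero None (Some z1) (Some z2) <-> z1 = z2.
Proof.
split=> [[P1 [P2 [P3 [/xcoord_None-> x1 x2]]]]|->].
  rewrite add0r => /eqP; rewrite addr_eq0 => /eqP P2E.
  by move: x1; rewrite P2E xcoordN x2 => -[].
have [P xP] := xcoord_ex (Some z2).
by exists 0, P, (- P); rewrite add0r subrr xcoordN.
Qed.

(** The product of the three point ideals is generated by [y - l], so the sum has trivial class.
    Multiple intersections are included. *)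
Lemma line_sum_zero (l : {poly K}) (x1 x2 x3 : K) :
  w - l ^+ 2 = ('X - x1%:P) * ('X - x2%:P) * ('X - x3%:P) ->
  sum3_zero (Some x1) (Some x2) (Some x3).
Proof.
move=> wE.
have on t : (w - l ^+ 2).[t] = 0 -> on_curve a b (Some (t, l.[t])).
  by rewrite hornerD hornerN horner_exp on_curveE eq_sym -subr_eq0 => /eqP.
have on1 : on_curve a b (Some (x1, l.[x1])).
  by apply: on; rewrite wE !hornerM !hornerXsubC subrr !mul0r.
have on2 : on_curve a b (Some (x2, l.[x2])).
  by apply: on; rewrite wE !hornerM !hornerXsubC subrr !(mulr0, mul0r).
have on3 : on_curve a b (Some (x3, l.[x3])).
  by apply: on; rewrite wE !hornerM !hornerXsubC subrr !mulr0.
pose pt P onP : E := exist (fun P => on_curve a b P) P onP.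
exists (pt _ on1), (pt _ on2), (pt _ on3); split=> //.
rewrite -addrA; apply: val_inj.
have on23 := on_curve_add on2 on3; have on123 := on_curve_add on1 on23.
apply: (point_ideal_inj two_neq0 smooth on123) => //=.
have := point_ideal_chord two_neq0 smooth wE => /same_class_principal H.
have refl T : same_class (point_ideal a b T) (point_ideal a b T) by
  apply/eqideal_class/eqideal_refl.
apply: same_class_trans (same_class_sym (point_ideal_add two_neq0 smooth on1
  on23)) _.
apply: same_class_trans (same_class_mul (refl _) (same_class_sym
  (point_ideal_add two_neq0 smooth on2 on3))) _.
exact/H/(chord_lreg wE).
Qed.

(* The third summation polynomial is e_2'^2 - 4 e_1 e_3' with e_2' = e_2 - a and
   e_3' = e_3 + b: the condition that some line y = m x + c meets the curve in
   x_1, x_2, x_3, that is m^2 = e_1, 2 m c = - e_2' and c^2 = e_3'. *)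
Lemma sum3_zero_SSS z1 z2 z3 : sum3_zero (Some z1) (Some z2) (Some z3) <->
  (z1 * z2 + z1 * z3 + z2 * z3 - a) ^+ 2 -
    4%:R * (z1 + z2 + z3) * (z1 * z2 * z3 + b) = 0.
Proof.
split=> [[[P1 onP1] [[P2 onP2] [[P3 onP3] [x1 x2 x3 S0]]]]|].
  case: P1 onP1 x1 S0 => [[t1 y1]|] //= on1 [<-].
  case: P2 onP2 x2 => [[t2 y2]|] //= on2 [<-].
  case: P3 onP3 x3 => [[t3 y3]|] //= on3 [<-] S0.
  have {}S0 : ec_add a (Some (t1, y1)) (Some (t2, y2)) = Some (t3, - y3).
    by move/eqP: S0; rewrite addr_eq0 => /eqP/(congr1 val).
  have [opp|nopp] := boolP ((t1 == t2) && (y1 == - y2)).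
    by move: S0; rewrite /ec_add opp.
  have [m [c [x3 [_ _ wE]]]] := ec_add_chord on1 on2 nopp.
  rewrite S0 => -[x3E _]; rewrite -{}x3E in wE.
  have /line_coefE[m1 m2 m3] := wE.
  rewrite [_ + b]addrC -m1 -m3 -sqrrN opprB -m2; ring.
have [m m1] := sqrt_ex (z1 + z2 + z3); move=> f0.
suff [c [m2 m3]] : exists c, 2%:R * m * c = a - (z1 * z2 + z1 * z3 + z2 * z3) /\
   c ^+ 2 = b + z1 * z2 * z3.
  by apply: (@line_sum_zero (m%:P * 'X + c%:P)); apply/line_coefE.
(* If [m = 0], then [f0] is the second equation squared, and [c] comes from the third. Otherwise the
   second equation determines [c], and [f0] is the third multiplied by (2 m)^2. *)
have [m0|m0] := eqVneq m 0.
  have [c cE] := sqrt_ex (b + z1 * z2 * z3); exists c; split=> //.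
  move: f0; rewrite -m1 m0 expr0n mulr0 !mul0r mulr0 mul0r subr0 => /eqP.
  by rewrite sqrf_eq0 -opprB oppr_eq0 => /eqP.
exists ((a - (z1 * z2 + z1 * z3 + z2 * z3)) / (2%:R * m)).
have d0 : 2%:R * m != 0 by rewrite mulf_neq0.
split; first by rewrite mulrC divfK.
rewrite expr_div_n -[RHS](@mulfK _ ((2%:R * m) ^+ 2)) ?expf_neq0 //.
congr (_ / _); apply/eqP; rewrite -subr_eq0 exprMn m1 -f0; apply/eqP; ring.
Qed.

End XCoordinates.

Section Semaev.

Variables (F : fieldType) (K : closedFieldType) (iota : {rmorphism F -> K}).
Variables (A B : F).
Local Notation a := (iota A).
Local Notation b := (iota B).
Variables (two_neq0 : 2%:R != 0 :> K)
  (smooth : 4%:R * a ^+ 3 + 27%:R * b ^+ 2 != 0).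
Local Notation E := (curve two_neq0 smooth).

Definition sum_zero m (Z : 'I_m -> option K) := exists P : 'I_m -> E,
  (forall i, xcoord (P i) = Z i) /\ \sum_i P i = 0.

Lemma sum_zero3 (Z : 'I_3 -> option K) : sum_zero Z <->
  sum3_zero two_neq0 smooth (Z (inord 0)) (Z (inord 1)) (Z (inord 2)).
Proof.
have i0 : inord 0 = ord0 :> 'I_3 by apply: val_inj; rewrite /= inordK.
have i1 : inord 1 = lift ord0 ord0 :> 'I_3 by apply: val_inj; rewrite /= inordK.
have i2 : inord 2 = lift ord0 (lift ord0 ord0) :> 'I_3.
  by apply: val_inj; rewrite /= inordK.
rewrite i0 i1 i2; split=> [[P [PZ P0]]|[P1 [P2 [P3 [x1 x2 x3 P0]]]]].
  exists (P ord0), (P (lift ord0 ord0)), (P (lift ord0 (lift ord0 ord0))).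
  by split; rewrite ?PZ // -[RHS]P0 !big_ord_recl big_ord0 addr0 addrA.
exists (fun i : 'I_3 => nth 0 [:: P1; P2; P3] i); split; last first.
  by rewrite !big_ord_recl big_ord0 addr0 addrA.
by case=> [[|[|[|]]]] // i; rewrite /= ?x1 ?x2 ?x3; congr (Z _); apply: val_inj.
Qed.

Lemma sum_zero_extend c (Z : 'I_c -> option K) u : sum_zero (extend Z u) <->
  exists (P : 'I_c -> E) Q,
    [/\ forall i, xcoord (P i) = Z i, xcoord Q = u & \sum_i P i + Q = 0].
Proof.
split=> [[P [PZ P0]]|[P [Q [PZ Qu PQ0]]]].
  exists (fun i => P (lift ord_max i)), (P ord_max).
  split=> [i||]; rewrite ?PZ ?extend_lift ?extend_max //.
  by rewrite -[RHS]P0 [RHS](bigD1_ord ord_max) //= addrC.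
exists (extend P Q); split=> [i|].
  by rewrite /extend; case: unlift.
rewrite (bigD1_ord ord_max) //= extend_max -[RHS]PQ0 addrC; congr (_ + _).
by apply: eq_bigr => i _; rewrite extend_lift.
Qed.

(** Two points with the same coordinate [u] are equal or opposite. If they are equal, negating all
    points of the second half makes the halves cancel. Conversely, [u] is the coordinate of a
    partial sum, infinite if that sum is zero. *)
Lemma sum_zero_split c d (Z : 'I_(c + d) -> option K) :
  (exists u, sum_zero (extend (fun i => Z (lshift d i)) u) /\
             sum_zero (extend (fun i => Z (rshift c i)) u)) <-> sum_zero Z.
Proof.
split=> [[u [/sum_zero_extend[P [Q [PZ Qu PQ0]]] /sum_zero_extend[P' [Q' [P'Z
  Q'u PQ0']]]]]|].
  have [P'' [P''Z P0]] : exists P'' : 'I_d -> E,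
      (forall i, xcoord (P'' i) = Z (rshift c i)) /\ \sum_i P i + \sum_i P''
        i = 0.
    have PQ : \sum_i P i = - Q by apply/eqP; rewrite -addr_eq0 PQ0.
    have PQ' : \sum_i P' i = - Q' by apply/eqP; rewrite -addr_eq0 PQ0'.
    have [QQ|QQ] := xcoord_eq (etrans Qu (esym Q'u)).
      exists (fun i => - P' i); split=> [i|]; first by rewrite xcoordN.
      by rewrite sumrN PQ PQ' QQ subrr.
    by exists P'; split=> //; rewrite PQ PQ' QQ opprK subrr.
  exists (fun i => match split i with inl k => P k | inr k => P'' k end).
  split=> [i|].
    by rewrite -[in RHS](splitK i); case: split => k /=.
  rewrite big_split_ord /= -[RHS]P0; congr (_ + _); apply: eq_bigr => i _.
    by rewrite -[lshift _ _]/(unsplit (inl i)) unsplitK.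
  by rewrite -[rshift _ _]/(unsplit (inr i)) unsplitK.
move=> [P [PZ]]; rewrite big_split_ord /= => P0.
exists (xcoord (- \sum_i P (lshift d i))); split; apply/sum_zero_extend.
  exists (fun i => P (lshift d i)), (- \sum_i P (lshift d i)).
  by split=> [i||]; rewrite ?PZ ?subrr.
exists (fun i => P (rshift c i)), (\sum_i P (lshift d i)).
by split=> [i||]; rewrite ?PZ ?xcoordN // addrC.
Qed.

(** All points but one are zero, so the sum is a nonzero point. Such tuples witness the nonvanishing
    hypotheses of [vanishes_on_res]. *)
Lemma sum_zero_one_finite c (i0 : 'I_c) (x : K) :
  ~ sum_zero (extend (fun i => if i == i0 then Some x else None) None).
Proof.
move=> /sum_zero_extend[P [Q [PZ /xcoord_None->]]].
rewrite addr0 (bigD1 i0) //= big1 ?addr0 => [P0|i /negPf ii]; last first.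
  by apply: xcoord_None; rewrite PZ ii.
by have := PZ i0; rewrite P0 eqxx xcoord0.
Qed.

Lemma specialize_semaev3 (Z : 'I_3 -> option K) (p :=
  fun i => proj_coord (Z (inord i))) :
  specialize iota Z (semaev3 A B) =
  (p 0%N * p 1%N + p 0%N * p 2%N + p 1%N * p 2%N - a%:P) ^+ 2 -
  4%:R * (p 0%N + p 1%N + p 2%N) * (p 0%N * p 1%N * p 2%N + b%:P).
Proof.
have X i : specialize iota Z 'X_(inord i) = p i by rewrite /specialize mmapX
  mmap1U.
have C c : specialize iota Z c%:MP = (iota c)%:P by rewrite /specialize mmapC.
rewrite /semaev3 !(rmorphB, rmorphD, rmorphM, rmorphXn, rmorph_nat) /= !X !C.
ring.
Qed.

Lemma coef_Poly_iff (p : {poly K}) s N (S : Prop) :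
  p = Poly s -> (size s <= N.+1)%N -> (s`_N = 0 <-> S) ->
  (size p <= N.+1)%N /\ (p`_N = 0 <-> S).
Proof.
by move=> -> sN; rewrite coef_Poly; split=> //;
  apply: leq_trans (size_Poly _) sN.
Qed.

(** The coefficient at [N] is the polynomial itself if no coordinate is infinite, (z1 - z2)^2 if one
    is, 1 if two are and 0 if all are, which matches the possible zero sums. *)
Lemma semaev3_cases u0 u1 u2 :
  let p0 := proj_coord u0 in let p1 := proj_coord u1 in let p2 :=
    proj_coord u2 in
  let f := (p0 * p1 + p0 * p2 + p1 * p2 - a%:P) ^+ 2 -
    4%:R * (p0 + p1 + p2) * (p0 * p1 * p2 + b%:P) in
  let N := (((u0 == None) + (u1 == None) + (u2 == None)) * 2)%N in
  (size f <= N.+1)%N /\ (f`_N = 0 <-> sum3_zero two_neq0 smooth u0 u1 u2).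
Proof.
have NSS z1 z2 (S : Prop) : (sum3_zero two_neq0 smooth None (Some z1) (Some
  z2) <-> S) ->
    ([:: (z1 * z2 - a) ^+ 2 - 4%:R * b * (z1 + z2);
      - 2%:R * ((z1 + z2) * (z1 * z2 + a) + 2%:R * b);
        (z1 - z2) ^+ 2]`_2 = 0 <-> S).
  move=> <-; rewrite sum3_zero_NSS /=; split=> [/eqP|->];
    last by rewrite subrr expr0n.
  by rewrite sqrf_eq0 subr_eq0 => /eqP.
have NNS z (S : Prop) : (sum3_zero two_neq0 smooth None None (Some z) <-> S) ->
    ([:: a ^+ 2 - 4%:R * b * z; - 4%:R * a * z - 8%:R * b;
        - 2%:R * a; - 4%:R * z; 1]`_4 = 0 <-> S).
  move=> <-; split=> [/eqP|/sum3_zero_NNS//]; by rewrite oner_eq0.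
have C12 := sum3_zeroC12 two_neq0 smooth;
  have C23 := sum3_zeroC23 two_neq0 smooth.
case: u0 u1 u2 => [z0|] [z1|] [z2|] /=.
- apply: (@coef_Poly_iff _ [:: (z0 * z1 + z0 * z2 + z1 * z2 - a) ^+ 2 -
    4%:R * (z0 + z1 + z2) * (z0 * z1 * z2 + b)]) => //=.
    by rewrite cons_poly_def mul0r add0r; ring.
  by apply: iff_sym; apply: sum3_zero_SSS.
- apply: coef_Poly_iff (NSS z0 z1 _ _) => //=;
  first by rewrite !cons_poly_def; ring.
  by apply: iff_trans (C12 _ _ _) _; apply: C23.
- apply: coef_Poly_iff (NSS z0 z2 _ _) => //=;
  first by rewrite !cons_poly_def; ring.
- apply: coef_Poly_iff (NNS z0 _ _) => //=; first by rewrite !cons_poly_def;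
  ring.
  by apply: iff_trans (C23 _ _ _) _; apply: C12.
- apply: coef_Poly_iff (NSS z1 z2 _ _) => //=; by rewrite !cons_poly_def; ring.
- apply: coef_Poly_iff (NNS z1 _ _) => //=; first by rewrite !cons_poly_def;
  ring.
- apply: coef_Poly_iff (NNS z2 _ _) => //=; by rewrite !cons_poly_def; ring.
(* The degree is at most 4 while [N = 6], so the coefficient is the default 0, in accordance with
   the sum of three zeros. *)
apply: (@coef_Poly_iff _ [:: a ^+ 2; - 12%:R * b; - 6%:R * a; 0;
  - 3%:R]) => //=.
  by rewrite !cons_poly_def; ring.
by split=> // _; apply: sum3_zero_NNN.
Qed.

Lemma semaev3_vanishes : vanishes_on iota 2 (semaev3 A B) (@sum_zero 3).
Proof.
move=> Z.
have -> : n_infty Z =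
    ((Z (inord 0) == None) + (Z (inord 1) == None) + (Z (inord 2) == None))%N.
  have -> : n_infty Z = (\sum_(i < 3) (Z (inord i) == None))%N.
    by apply: eq_bigr => i _; rewrite inord_val.
  by rewrite !big_ord_recr big_ord0.
rewrite specialize_semaev3.
have [sf fE] := semaev3_cases (Z (inord 0)) (Z (inord 1)) (Z (inord 2)).
by split=> //; apply: iff_trans fE (iff_sym (sum_zero3 Z)).
Qed.

(** Induction along the recursion: a resultant multiplies the degrees in each variable, whence the
    powers of 2, and joins the two zero sums by [sum_zero_split]. *)
Theorem summation_poly_vanishes m (f : {mpoly F[m]}) :
  summation_poly A B f -> vanishes_on iota (2 ^ (m - 2)) f (@sum_zero m).
Proof.
elim=> [|c d g h gP gV hP hV]; first exact: semaev3_vanishes.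
have c2 : (1 < c)%N := summation_poly_ge3 gP.
have d2 : (1 < d)%N := summation_poly_ge3 hP.
have -> : (2 ^ (c + d - 2) = 2 ^ (c.+1 - 2) * 2 ^ (d.+1 - 2))%N.
  by rewrite -expnD; congr (2 ^ _)%N; lia.
have ex n n' (s : 'I_n -> 'I_n') : (0 < n)%N -> injective s ->
    exists Z : 'I_n' -> option K, ~ sum_zero (extend (fun i => Z (s i)) None).
  move=> n0 sinj; pose i0 := Ordinal n0.
  exists (fun j => if j == s i0 then Some 0 else None) => -[P [PZ P0]].
  apply: (@sum_zero_one_finite _ i0 0); exists P; split=> // i.
  rewrite PZ /extend; case: unlift => // j.
  by rewrite (inj_eq sinj).
have res := vanishes_on_res gV hV _ _ (ex _ _ _ _ (@lshift_inj c d)) (ex _ _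
  _ _ (@rshift_inj c d)).
move=> Z; have [||||sf fE] := res _ _ _ _ Z; rewrite ?expn_gt0 //;
  try exact: ltnW.
by split=> //; apply: iff_trans fE (sum_zero_split Z).
Qed.

Corollary semaev_theorem m (f : {mpoly F[m]}) (v : 'I_m -> K) :
  summation_poly A B f ->
  (map_mpoly iota f).@[v] = 0 <-> sum_zero (fun i => Some (v i)).
Proof.
move=> /summation_poly_vanishes/(_ (fun i => Some (v i)))[_ <-].
by rewrite n_infty_Some mul0n specialize_Some coefC.
Qed.

End Semaev.

(** * Sums over the orbit of an additive map *)

Section CyclicTrace.

Variables (V : zmodType) (phi : {additive V -> V}) (n : nat).
Implicit Types (p : V) (N : {set 'I_n}).

Definition cyc_trace p : V := \sum_(i < n) iter i phi p.

Lemma iter_additive k : {morph iter k phi : p q / p + q}.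
Proof. by elim: k => // k IHk p q /=; rewrite IHk raddfD. Qed.

Lemma iter_sum k (I : finType) (P : pred I) (f : I -> V) :
  iter k phi (\sum_(i | P i) f i) = \sum_(i | P i) iter k phi (f i).
Proof.
apply: big_morph; first exact: iter_additive.
by elim: k => //= k ->; rewrite raddf0.
Qed.

Lemma iter_mulrn k p m : iter k phi (p *+ m) = iter k phi p *+ m.
Proof. by elim: k => //= k ->; rewrite raddfMn. Qed.

Lemma cyc_trace_additive : {morph cyc_trace : p q / p + q}.
Proof.
by move=> p q; rewrite -big_split; apply: eq_bigr => i _; rewrite iter_additive.
Qed.

Lemma cyc_trace_fixed p : phi p = p -> cyc_trace p = p *+ n.
Proof.
move=> fix_p; rewrite /cyc_trace (eq_bigr (fun=> p)).
  by rewrite sumr_const card_ord.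
by move=> i _; elim: (nat_of_ord i) => //= k ->.
Qed.

Variable p : V.
Hypothesis p_n : iter n phi p = p.

Lemma phi_cyc_trace : phi (cyc_trace p) = cyc_trace p.
Proof.
rewrite raddf_sum -[LHS](addrK p).
have -> : \sum_(i < n) phi (iter i phi p) + p = \sum_(i < n.+1) iter i phi p.
  by rewrite big_ord_recl addrC.
by rewrite big_ord_recr /= p_n addrK.
Qed.

Lemma cyc_trace_iter k : cyc_trace (iter k phi p) = cyc_trace p.
Proof.
have -> : cyc_trace (iter k phi p) = iter k phi (cyc_trace p).
  by rewrite iter_sum; apply: eq_bigr => i _; rewrite -!iterD addnC.
by elim: k => //= k ->; apply: phi_cyc_trace.
Qed.

(** The vanishing of the signed orbit sum of [p] with minus signs exactly on [N], rewritten through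
    the trace. *)
Definition sign_relation N := cyc_trace p = (\sum_(i in N) iter i phi p) *+ 2.

Lemma sign_relationC N : sign_relation N -> sign_relation (~: N).
Proof.
rewrite /sign_relation => NE;
  apply: (addIr ((\sum_(i in N) iter i phi p) *+ 2)).
rewrite -mulrnDl addrC [X in _ = X *+ 2](_ : _ = cyc_trace p).
  by rewrite -NE mulr2n.
rewrite /cyc_trace [RHS](bigID (mem N)) /=; congr (_ + _).
by apply: eq_bigl => i; rewrite inE.
Qed.

(** Take the trace of both sides: the trace of [p] is fixed by [phi], and all conjugates of [p] have
    the same trace. *)
Lemma sign_relation_card N :
  sign_relation N -> cyc_trace p *+ n = cyc_trace p *+ (#|N| * 2).
Proof.
move=> NE; rewrite -(cyc_trace_fixed phi_cyc_trace) {1}NE.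
rewrite /cyc_trace; under eq_bigr do rewrite iter_mulrn iter_sum.
rewrite sumrMnl exchange_big /= mulrnA; congr (_ *+ _).
by rewrite -sumr_const; apply: eq_bigr => i _; apply: cyc_trace_iter.
Qed.

Lemma sign_relation_le N : sign_relation N ->
  exists2 M, sign_relation M & (#|M| * 2 <= n)%N.
Proof.
move=> NE; have [le|lt] := leqP (#|N| * 2) n; first by exists N.
exists (~: N); first exact: sign_relationC.
have := cardsC N; rewrite card_ord; lia.
Qed.

Lemma sign_relation0 : sign_relation set0 <-> cyc_trace p = 0.
Proof. by rewrite /sign_relation big_set0 mul0rn. Qed.

End CyclicTrace.

Lemma sign_relation3 (V : zmodType) (phi : {additive V -> V}) p :
  iter 3 phi p = p ->
  (exists N : {set 'I_3}, sign_relation phi p N) <-> cyc_trace phi 3 p = 0.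
Proof.
move=> p3; split=> [[N /sign_relation_le[M ME M2]]|]; last first.
  by exists set0; apply/sign_relation0.
have [M0|M1] : #|M| = 0%N \/ #|M| = 1%N by lia.
  by apply/sign_relation0; rewrite -(cards0_eq M0).
(* One negative sign gives 3 Tr p = 2 Tr p. *)
have := sign_relation_card p3 ME; rewrite M1 mulrSr => /eqP.
by rewrite addrC -subr_eq0 addrK => /eqP.
Qed.

Lemma sign_relation5 (V : zmodType) (phi : {additive V -> V}) p :
  iter 5 phi p = p ->
  (exists N : {set 'I_5}, sign_relation phi p N) <->
  cyc_trace phi 5 p = 0 \/
  exists Q R, [/\ Q *+ 3 = 0, phi Q = Q,
    [/\ R *+ 2 = 0, iter 5 phi R = R & cyc_trace phi 5 R = 0] & p = Q + R].
Proof.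
move=> p5; split=> [[N /sign_relation_le[M ME M2]]|]; last first.
  case=> [|[Q [R [Q3 phiQ [R2 R5 TR] pE]]]].
    by exists set0; apply/sign_relation0.
  (* Here Tr p = Tr Q = 5 Q = 2 Q = 2 p. *)
  exists [set ord0]; rewrite /sign_relation big_set1 /= pE cyc_trace_additive
    TR addr0.
  rewrite mulrnDl R2 addr0 cyc_trace_fixed //
    -[5%N]/(3 + 2)%N mulrnDr Q3 add0r //.
set t := cyc_trace phi 5 p.
have phit : phi t = t by exact: phi_cyc_trace.
have card_M := sign_relation_card p5 ME; rewrite -/t in card_M.
have [M0|[M1|M2']] : #|M| = 0%N \/ #|M| = 1%N \/ #|M| = 2%N by lia.
- by left; apply/sign_relation0; rewrite -(cards0_eq M0).
- right; have t3 : t *+ 3 = 0.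
    by apply: (addIr (t *+ 2)); rewrite -mulrnDr add0r card_M M1.
  have /eqP/cards1P[j Mj] := M1.
  (* The relation is t = 2 phi^j(p); applying phi^(5 - j) brings back [p] and fixes [t]. *)
  have tE : t = p *+ 2.
    have : t = iter j phi p *+ 2 by rewrite /t ME Mj big_set1.
    move=> /(congr1 (iter (5 - j) phi));
      rewrite iter_mulrn -iterD subnK ?p5; last exact: ltnW.
    by move=> <-; elim: (5 - j)%N => //= k <-.
  (* From t = 2 p and 3 t = 0: 2 (p + t) = 3 t = 0 and Tr (p + t) = t + 5 t = 0. *)
  exists (- t), (p + t); split; last by rewrite addrC addrK.
  + by rewrite mulNrn t3 oppr0.
  + by rewrite raddfN phit.
  split.
  + by rewrite mulrnDl -tE -{1}[t]mulr1n -mulrnDr.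
  + rewrite iter_additive p5; congr (_ + _); by rewrite /= !phit.
  + rewrite cyc_trace_additive (cyc_trace_fixed _ phit) -/t -{1}[t]mulr1n
    -mulrnDr.
    by rewrite (mulrnA t 3 2) t3 mul0rn.
(* Two negative signs give 5 t = 4 t. *)
left; move: card_M; rewrite M2' -[5%N]/(1 + 2 * 2)%N mulrnDr => /eqP.
by rewrite -subr_eq0 addrK => /eqP.
Qed.

(** * The Frobenius endomorphism *)

Section Frobenius.

Variables (F : finFieldType) (K : closedFieldType) (iota : {rmorphism F -> K}).
Local Notation q := #|F|.

(* The ring morphism argument provides the characteristic of K. *)
Definition frob_hom of {rmorphism F -> K} : K -> K := fun x => x ^+ q.
Local Notation sigma := (frob_hom iota).

Fact frob_hom_zmod_morphism : zmod_morphism sigma.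
Proof.
have [p pr_p pF] := finPcharP F.
have NK : [pchar K].-nat q.
  by rewrite (card_pprimeChar pF) pnatX pnatE // (fmorph_pchar iota) pF.
by move=> x y; rewrite /frob_hom exprDn_pchar // exprNn_pchar.
Qed.

Fact frob_hom_monoid_morphism : monoid_morphism sigma.
Proof. by split=> [|x y]; rewrite /frob_hom ?expr1n ?exprMn. Qed.

HB.instance Definition _ :=
  GRing.isZmodMorphism.Build K K sigma frob_hom_zmod_morphism.
HB.instance Definition _ :=
  GRing.isMonoidMorphism.Build K K sigma frob_hom_monoid_morphism.

Lemma frob_hom_iota c : sigma (iota c) = iota c.
Proof. by rewrite /frob_hom -rmorphXn expf_card. Qed.

(** Over [F], X^q - X is the product of the X - c for all c in [F], so its roots in [K] are the
    images of these c. *)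
Lemma frob_hom_fixed x : (sigma x == x) = (x \in codom iota).
Proof.
apply/eqP/codomP => [|[c ->]]; last exact: frob_hom_iota.
move=> sx; have : root ('X^q - 'X) x by rewrite rootE !hornerE subr_eq0;
  apply/eqP.
have -> : 'X^q - 'X = map_poly iota ('X^q - 'X) by rewrite rmorphB /=
  map_polyXn map_polyX.
rewrite finField_genPoly rmorph_prod rootE horner_prod => /prodf_eq0[c _].
by rewrite /= map_polyXsubC hornerXsubC subr_eq0 => /eqP->; exists c.
Qed.

Lemma iter_frob_hom n x : iter n sigma x = x ^+ (q ^ n).
Proof. by elim: n => [|n IHn];
  rewrite ?expr1 //= IHn /frob_hom -exprM -expnSr. Qed.

Variables (A B : F).
Local Notation a := (iota A).
Local Notation b := (iota B).

Lemma frob_ec_add P Q : frob q (ec_add a P Q) = ec_add a (frob q P) (frob q Q).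
Proof.
case: P Q => [[x y]|] [[x' y']|] //.
rewrite /= -![_ ^+ q]/(sigma _) -rmorphN !fmorph_eq.
case: ifP => //= _; rewrite -![_ ^+ q]/(sigma _).
have E : sigma (if x == x' then (3%:R * x ^+ 2 + a) / (2%:R * y) else (y' -
  y) / (x' - x))
  = (if x == x' then (3%:R * sigma x ^+ 2 + a) / (2%:R * sigma y)
     else (sigma y' - sigma y) / (sigma x' - sigma x)).
  case: ifP => _; rewrite fmorph_div !(rmorphB, rmorphD, rmorphM, rmorphXn,
    rmorph_nat) //=.
  by rewrite frob_hom_iota.
by rewrite -E !(rmorphB, rmorphM, rmorphXn).
Qed.

Lemma on_curve_frob P : on_curve a b P -> on_curve a b (frob q P).
Proof.
case: P => [[x y]|] //= /eqP onP; rewrite -![_ ^+ q]/(sigma _).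
rewrite -rmorphXn onP !(rmorphD, rmorphM, rmorphXn) /=.
by rewrite !frob_hom_iota.
Qed.

Variables (two_neq0 : 2%:R != 0 :> K)
  (smooth : 4%:R * a ^+ 3 + 27%:R * b ^+ 2 != 0).
Local Notation E := (curve two_neq0 smooth).

Definition curve_frob (P : E) : E :=
  exist (fun P => on_curve a b P) _ (on_curve_frob (valP P)).

Fact curve_frob_zmod_morphism : zmod_morphism curve_frob.
Proof.
have frobD P Q : curve_frob (P + Q) = curve_frob P + curve_frob Q.
  by apply: val_inj; apply: frob_ec_add.
by move=> P Q; rewrite -[X in _ = curve_frob X - _](subrK Q) [curve_frob (P -
  Q + Q)]frobD addrK.
Qed.

HB.instance Definition _ := GRing.isZmodMorphism.Build E E curve_frob
  curve_frob_zmod_morphism.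

Local Notation phi := curve_frob.

Lemma val_iter_frob n P : val (iter n phi P) = iter n (frob q) (val P).
Proof. by elim: n => //= n ->. Qed.

Lemma iter_frobE n (P : point K) : iter n (frob q) P =
  if P is Some (x, y) then Some (x ^+ (q ^ n), y ^+ (q ^ n)) else None.
Proof.
case: P => [[x y]|]; rewrite -?iter_frob_hom; by elim: n => //= n ->.
Qed.

Lemma iter_frob_rational n (P : E) : iter n phi P = P <-> ec_rat a b (Fqn F
  n) (val P).
Proof.
have -> : iter n phi P = P <-> iter n (frob q) (val P) = val P.
  by rewrite -val_iter_frob; split=> [->|/val_inj].
rewrite /ec_rat (valP P) iter_frobE; case: (val P) => [[x y]|] //.
rewrite andTb; split=> [[xE yE]|/andP[/eqP xE /eqP yE]]; last by rewrite xE yE.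
by apply/andP; split; apply/eqP.
Qed.

Lemma frob_rational (P : E) :
  phi P = P <-> rational [pred x : K | x \in codom iota] (val P).
Proof.
have -> : phi P = P <-> frob q (val P) = val P.
  by split=> [/(congr1 val)//|?]; apply: val_inj.
case: (val P) => [[x y]|] //=; rewrite -!frob_hom_fixed.
by split=> [[xE yE]|/andP[/eqP xE /eqP yE]]; [apply/andP; split;
  apply/eqP|congr (Some (_, _))].
Qed.

Lemma ec_traceE n (P : E) : ec_trace a q n (val P) = val (cyc_trace phi n P).
Proof.
rewrite /cyc_trace (big_morph (fun P : E => val P) (id1 := None) (op1 :=
  ec_add a)) //.
by apply: eq_bigr => i _; rewrite val_iter_frob.
Qed.

Lemma ec_mulnE m (P : E) : ec_muln a m (val P) = val (P *+ m).
Proof.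
elim: m => // m IHm; rewrite mulrS.
by rewrite -[LHS]/(ec_add a (val P) (ec_muln a m (val P))) IHm.
Qed.

Lemma val_eq0 (P : E) : val P = None <-> P = 0.
Proof. by split=> [P0|-> //]; apply: val_inj. Qed.

Lemma ec_torsionE m (P : E) : ec_torsion a b m (val P) <-> P *+ m = 0.
Proof.
by rewrite /ec_torsion (valP P) ec_mulnE; split=> [/eqP/val_eq0|->].
Qed.

Lemma trace_zeroE n (P : E) :
  trace_zero F a b n (val P) <-> iter n phi P = P /\ cyc_trace phi n P = 0.
Proof.
rewrite /trace_zero ec_traceE;
  split=> [/andP[/iter_frob_rational PE /eqP/val_eq0]|] //.
by case=> /iter_frob_rational PE P0; rewrite PE P0.
Qed.

(** A point with the same x-coordinate as a conjugate of [P] is that conjugate or its opposite, so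
    zero sums are choices of signs. *)
Lemma sum_zero_sign_relation n (P : E) :
  sum_zero two_neq0 smooth (fun i : 'I_n => xcoord (iter i phi P)) <->
  exists N : {set 'I_n}, sign_relation phi P N.
Proof.
have signs (N : {set 'I_n}) :
    \sum_(i < n) (if i \in N then - iter i phi P else iter i phi P) =
    cyc_trace phi n P - (\sum_(i in N) iter i phi P) *+ 2.
  rewrite /cyc_trace [LHS](bigID (mem N)) [X in X - _](bigID (mem N)) /=.
  rewrite (eq_bigr (fun i : 'I_n => - iter i phi P)) => [|i ->] //.
  rewrite [X in _ + X](eq_bigr (fun i : 'I_n => iter i phi P)) =>
    [|i /negPf->] //.
  by rewrite sumrN mulr2n opprD addrA [X in X - _ - _]addrC addrK addrC.
split=> [[Q [QP Q0]]|[N NP]].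
  (* Where a conjugate equals its opposite, the sign is taken to be positive. *)
  exists [set i | Q i != iter i phi P]; apply/eqP;
    rewrite -subr_eq0 -signs -[eqbRHS]Q0.
  apply/eqP/eq_bigr => i _; rewrite inE; case: eqVneq => //= QiP.
  by have [QE|->//] := xcoord_eq (QP i); rewrite QE eqxx in QiP.
exists (fun i => if i \in N then - iter i phi P else iter i phi P);
  split=> [i|].
  by case: ifP => _ //; rewrite xcoordN.
by rewrite signs NP subrr.
Qed.

(** The conjugates of (X, Y) have x-coordinates X^(q^i), so Semaev's theorem yields the signs. The
    point at infinity, absent from the affine locus, satisfies every sign relation. *)
Lemma frob_zero_locusE n (f : {mpoly F[n]}) (P : E) : summation_poly A B f ->
  frob_zero_locus iota a b f (val P) \/ val P = None <->
  iter n phi P = P /\ exists N : {set 'I_n}, sign_relation phi P N.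
Proof.
move=> fP; have xc x y : val P = Some (x, y) ->
    forall i, xcoord (iter i phi P) = Some (x ^+ (q ^ i)).
  by move=> PE i; rewrite /xcoord val_iter_frob PE iter_frobE.
split=> [[[X [Y [PE /iter_frob_rational Pn
  f0]]]|/val_eq0->]|[/iter_frob_rational Pn NP]].
- split=> //; apply/sum_zero_sign_relation.
  move/(semaev_theorem two_neq0 smooth _ fP): f0 => -[Q [QE Q0]].
  by exists Q; split=> // i; rewrite QE (xc _ _ PE).
- have it0 k : iter k phi 0 = 0 by elim: k => //= k ->; rewrite raddf0.
  split; first exact: it0.
  by exists set0; apply/sign_relation0; rewrite /cyc_trace big1.
case PE: (val P) => [[X Y]|]; [left | by right].
exists X, Y; rewrite -PE; split=> //.
move/sum_zero_sign_relation: NP => [Q [QE Q0]].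
apply/(semaev_theorem two_neq0 smooth _ fP); exists Q; split=> // i.
by rewrite QE (xc _ _ PE).
Qed.

End Frobenius.

(** * The trace zero subgroups for n = 3 and n = 5 *)

Theorem proposition14 (F : finFieldType)
    (char2 : 2%N \notin [pchar F]) (char3 : 3%N \notin [pchar F])
    (K : closedFieldType) (iota : {rmorphism F -> K})
    (algK : is_alg_closure iota)
    (A B : F) (smooth : 4%:R * A ^+ 3 + 27%:R * B ^+ 2 != 0)
    (f3 : {mpoly F[3]}) (f3P : summation_poly A B f3)
    (f5 : {mpoly F[5]}) (f5P : summation_poly A B f5) :
  let a := iota A in
  let b := iota B in
  let T := trace_zero F a b in
  let E3Fq := fun P : point K =>
    ec_torsion a b 3 P && rational [pred x : K | x \in codom iota] P in
  let E2T5 := fun P : point K => ec_torsion a b 2 P && T 5%N P in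
  (forall P : point K,
     T 3%N P <-> frob_zero_locus iota a b f3 P \/ P = None) /\
  (forall P : point K,
     T 5%N P \/ pt_sumset a E3Fq E2T5 P <->
     frob_zero_locus iota a b f5 P \/ P = None).
Proof.
move=> a b T E3Fq E2T5.
have two_neq0 : 2%:R != 0 :> K by rewrite -(rmorph_nat iota) fmorph_eq0;
  move: char2; rewrite !inE.
have smoothK : 4%:R * a ^+ 3 + 27%:R * b ^+ 2 != 0.
  have -> : 4%:R * a ^+ 3 + 27%:R * b ^+ 2 = iota (4%:R * A ^+ 3 + 27%:R * B
    ^+ 2).
    by rewrite !(rmorphD, rmorphM, rmorphXn, rmorph_nat).
  by rewrite fmorph_eq0.
pose pt P (onP : on_curve a b P) : curve two_neq0 smoothK :=
  exist (fun P => on_curve a b P) P onP.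
(* Both sides of each equality consist of points of the curve, so membership can be compared in the
   group [curve]. *)
have onT n P : T n P -> on_curve a b P by case/andP => /andP[].
have onL n (f : {mpoly F[n]}) P : frob_zero_locus iota a b f P \/ P = None ->
  on_curve a b P.
  by case=> [[X [Y [-> /andP[]]]]|->].
split=> P.
  suff H (onP : on_curve a b P) : T 3%N P <-> frob_zero_locus iota a b f3 P
    \/ P = None.
    by split=> h; [have /H[+ _] := onT _ _ h | have /H[_ +] := onL _ _ _ h];
      apply.
  rewrite -[P]/(val (pt P onP)) frob_zero_locusE // trace_zeroE.
  by split=> -[P3 HP]; split=> //; apply/(sign_relation3 P3).
suff H (onP : on_curve a b P) : T 5%N P \/ pt_sumset a E3Fq E2T5 P <->
    frob_zero_locus iota a b f5 P \/ P = None.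
  split=> h; last by have /H[_ +] := onL _ _ _ h; apply.
  apply/H => //; case: h => [/onT//|[Q [R [/andP[/andP[onQ _] _] /andP[_ /onT
    onR] ->]]]].
  exact: on_curve_add.
have sumE : pt_sumset a E3Fq E2T5 P <-> exists Q R : curve two_neq0 smoothK,
    [/\ Q *+ 3 = 0, curve_frob Q = Q,
      [/\ R *+ 2 = 0, iter 5 (@curve_frob F K iota A B two_neq0 smoothK) R = R &
         cyc_trace (@curve_frob F K iota A B two_neq0 smoothK) 5 R = 0]
      & pt P onP = Q + R].
  split=> [[Q [R [/andP[Q3 Qrat] /andP[R2 TR] PE]]]|[Q [R [Q3 Qrat [R2 R5 TR]
    PE]]]].
    have /andP[onQ _] := Q3; have onR := onT _ _ TR.
    exists (pt Q onQ), (pt R onR); move: TR;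
      rewrite -[R]/(val (pt R onR)) => /trace_zeroE[R5 TR].
    split; [exact/ec_torsionE|exact/frob_rational|split=> //;
      exact/ec_torsionE|].
    exact: val_inj.
  exists (val Q), (val R); split; last exact: (congr1 val PE).
    by apply/andP; split; [apply/ec_torsionE | apply/frob_rational].
  by apply/andP; split; [apply/ec_torsionE | apply/trace_zeroE].
rewrite sumE -[P in T _ P]/(val (pt P onP)) -[P in frob_zero_locus _ _ _ _
  P]/(val (pt P onP)).
rewrite -[P in P = None]/(val (pt P onP)) frob_zero_locusE // trace_zeroE.
split=> [[[P5 TP]|QR]|[P5 /(sign_relation5 P5)[TP|QR]]].
- by split=> //; apply/(sign_relation5 P5); left.
(* A sum Q + R is fixed by the fifth iterate of the Frobenius, as Q is fixed by the Frobenius itself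
   and R by its fifth iterate. *)
- have P5 : iter 5 (@curve_frob F K iota A B two_neq0 smoothK) (pt P onP) =
  pt P onP.
    case: QR => [Q [R [_ phiQ [_ R5 _] ->]]]; rewrite iter_additive R5.
    by congr (_ + _); rewrite /= !phiQ.
  by split=> //; apply/(sign_relation5 P5); right.
- by left.
by right.
Qed.
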